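(* Let $k \geq 3$ be an integer, let $C_{4,k}$ be the $k$-uniform hypercycle with length four, and let $\mathcal{A}_{C_{4,k}}$ be its adjacency tensor. Then the $3k$-th order trace of $\mathcal{A}_{C_{4,k}}$ is $$\mathrm{Tr}_{3k}(\mathcal{A}_{C_{4,k}})=4k^{k-1}(k-1)^{3k-4}+24k^{2k-3}(k-1)^{2k-3}+12k^{3k-5}(k-1)^{k-2}.$$
   Context: A $k$-uniform hypergraph $H=(V,E)$ is a finite vertex set $V$ together with a set $E$ of $k$-element subsets of $V$ (edges). The $k$-uniform hypercycle with length $m$, $C_{m,k}$, has vertices $v_1,v_2,\ldots,v_{m(k-1)+1}$ with $v_1=v_{m(k-1)+1}$ identified (and no other identifications), and edges $e_i=\{v_{(i-1)(k-1)+1},v_{(i-1)(k-1)+2},\ldots,v_{i(k-1)+1}\}$ for $i=1,\ldots,m$; equivalently it is obtained from the cycle graph of length $m$ by adding $k-2$ new vertices to every edge. Thus $C_{4,k}$ has $n=4(k-1)$ vertices and $4$ edges. The adjacency tensor of a $k$-uniform hypergraph $H$ on $n$ vertices (labelled $1,\ldots,n$) is the $k$-order $n$-dimensional tensor $\mathcal{A}_H=(a_{i_1i_2\ldots i_k})$ with $a_{i_1\ldots i_k}=\frac{1}{(k-1)!}$ if $\{i_1,\ldots,i_k\}\in E$ and $0$ otherwise. For a $k$-order $n$-dimensional tensor $\mathcal{T}=(t_{i_1\ldots i_k})$ over $\mathbb{C}$, the $j$-th order trace is $$\mathrm{Tr}_{j}(\mathcal{T})=(k-1)^{n-1}\sum_{j_{1}+\cdots+j_{n}=j}\Big[\prod_{i=1}^{n}\frac{1}{(j_{i}(k-1))!}\Big(\sum_{l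 \in [n]^{k-1}}t_{il}\frac{\partial}{\partial x_{il}}\Big)^{j_{i}}\Big] \mathrm{tr}(X^{j(k-1)}),$$ where $X=(x_{ij})$ is an $n\times n$ matrix of independent variables, $[n]=\{1,\ldots,n\}$, for $l=l_2\cdots l_k$ one writes $t_{il}=t_{il_2\ldots l_k}$ and $\frac{\partial}{\partial x_{il}}=\frac{\partial}{\partial x_{il_2}}\cdots\frac{\partial}{\partial x_{il_k}}$, and $j_1,\ldots,j_n$ run over all nonnegative integers with sum $j$. *)

(* Defs.v *)
From HB Require Import structures.
From mathcomp Require Import all_boot all_order all_algebra.
From mathcomp Require Import complex reals mpoly.

Set Implicit Arguments.
Unset Strict Implicit.
Unset Printing Implicit Defensive.

Import Order.TTheory GRing.Theory Num.Theory.

Local Open Scope ring_scope.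

(* A hypergraph on the vertex set V is given by its edge set. *)
Definition uniform_hypergraph (k : nat) (V : finType) (E : {set {set V}}) :=
  forall e, e \in E -> #|e| = k.

(* Vertices and edges are numbered from 0, and the vertex numbers are taken
   modulo m * (k - 1), which identifies the last vertex with the first one. *)
Definition hypercycle_edge (m k : nat) (i : 'I_m) : {set 'I_(m * k.-1)} :=
  [set v : 'I_(m * k.-1) |
    [exists t : 'I_k, val v == ((i * k.-1 + t) %% (m * k.-1))%N]].

Definition hypercycle (m k : nat) : {set {set 'I_(m * k.-1)}} :=
  [set hypercycle_edge k i | i : 'I_m].

Lemma hypercycle_uniform (m k : nat) :
  (1 < m)%N -> (1 < k)%N -> uniform_hypergraph k (hypercycle m k).
Proof.
case: k => [|[|k]] // m_gt1 _ _ /imsetP[i _ ->].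
have lt_kN : (k.+1 < m * k.+1)%N by rewrite -[X in (X < _)%N]mul1n ltn_mul2r.
have N_gt0 : (0 < m * k.+1)%N by apply: leq_trans lt_kN.
pose f (t : 'I_k.+2) : 'I_(m * k.+1) := Ordinal (ltn_pmod (i * k.+1 + t) N_gt0).
have inj_f : injective f.
  move=> s t /(congr1 val) /= /eqP; rewrite eqn_modDl => /eqP.
  have ltN (u : 'I_k.+2) : (u < m * k.+1)%N.
    by rewrite (leq_ltn_trans _ lt_kN) // -ltnS.
  by rewrite (modn_small (ltN s)) (modn_small (ltN t)) => /val_inj.
rewrite -[RHS](card_ord k.+2) -(card_imset _ inj_f); apply: eq_card => v.
rewrite inE; apply/existsP/imsetP => [[t /eqP vE]|[t _ ->]]; exists t => //.
exact: val_inj.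
Qed.

(* A k-order n-dimensional tensor: T i l is the entry t_{il}, where i is the
   first index and l = l_2 ... l_k collects the k - 1 other ones (k >= 1). *)
Definition tensor (C : Type) (k n : nat) := 'I_n -> k.-1.-tuple 'I_n -> C.

Definition adjacency_tensor (C : fieldType) (k n : nat)
    (E : {set {set 'I_n}}) : tensor C k n :=
  fun i l => if [set v in i :: l] \in E then (k.-1`!)%:R^-1 else 0.

Arguments adjacency_tensor C k {n} E.

Section Trace.

Variables (C : fieldType) (n : nat).

Local Notation P := {mpoly C[n * n]}.

Definition xvar (i j : 'I_n) : 'I_(n * n) := mxvec_index i j.

Definition generic_mx : 'M[P]_n := \matrix_(i, j) 'X_(xvar i j).

(* d/dx_{il} = d/dx_{i l_2} ... d/dx_{i l_k} *)
Definition partial_row (i : 'I_n) (l : seq 'I_n) (p : P) : P :=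
  foldr (fun j q => q^`M(xvar i j)) p l.

Definition tensor_diff (k : nat) (T : tensor C k n) (i : 'I_n) (p : P) : P :=
  \sum_(l : k.-1.-tuple 'I_n) T i l *: partial_row i l p.

(* The product over i is a composition of (commuting) differential operators.
   These have total order d * (k - 1), and are applied to a form of the same
   degree, so the result is a constant polynomial. *)
Definition tensor_trace (d k : nat) (T : tensor C k n) : P :=
  (k.-1)%:R ^+ n.-1 *
  \sum_(a : {ffun 'I_n -> 'I_d.+1} | (\sum_i a i)%N == d)
    (\big[comp/id]_(i < n) (fun p : P =>
        ((a i * k.-1)`!)%:R^-1 *: iter (a i) (tensor_diff T i) p))
      (\tr (generic_mx ^+ (d * k.-1))).

End Trace.

(* Main.v *)
(** The trace applies the operators [D_i] of order [k - 1], read off from the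
rows of the tensor, to the generating polynomial of closed walks.  Expanding
their powers, every choice of hyperarcs contributes the number of closed walks
with prescribed arc multiplicities, which Whittle's formula writes as
[prod (outdeg i)! / prod (arc multiplicity)!] times the trace of the adjugate
of the random walk Laplacian.  All factorials cancel against the normalisation.

For the hypercycle, being balanced forces every vertex to use the edge [q]
the same number [w q] of times, up to a circulation around the hypercycle; in
order [3 k] the weights [w] of the four edges add up to 3, so some edge is unused
and there is no circulation.  Since a step of the walk goes from a vertex to an
edge and back to a vertex, the trace of the adjugate reduces to that of a
4 x 4 matrix indexed by the edges, for each of the 20 choices of [w].  The
three summands of the theorem come from the weights supported on one edge, on two
adjacent edges and on three edges; two opposite edges contribute 0. *)

Require Import Defs.
From mathcomp Require Import all_boot all_order all_algebra.
From mathcomp Require Import complex reals mpoly.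
From mathcomp Require Import ssrcomplements zify ring.

Set Implicit Arguments.
Unset Strict Implicit.
Unset Printing Implicit Defensive.

Import Order.TTheory GRing.Theory Num.Theory.

Local Open Scope ring_scope.

(** * Adjugates *)

Lemma cofactor_eq_off_row (R : comNzRingType) n (A B : 'M[R]_n) (i j : 'I_n) :
  (forall i', i' != i -> A i' =1 B i') -> cofactor A i j = cofactor B i j.
Proof.
move=> eqAB; rewrite /cofactor; congr (_ * \det _); apply/matrixP=> r s.
by rewrite !mxE eqAB // eq_sym neq_lift.
Qed.

Lemma det_scale_rows (R : comNzRingType) n (g : 'I_n -> R) (A : 'M[R]_n) :
  \det (\matrix_(i, j) (g i * A i j)) = (\prod_i g i) * \det A.
Proof.
have -> : \matrix_(i, j) (g i * A i j) = diag_mx (\row_i g i) *m A.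
  by apply/matrixP=> i j; rewrite mul_diag_mx !mxE.
by rewrite det_mulmx det_diag; congr (_ * _); apply: eq_bigr => i _; rewrite mxE.
Qed.

(** The cofactor omits row [i], so the factor [g i] missing from it is put on the left instead of
    dividing by it. *)
Lemma cofactor_scale_rows (R : comNzRingType) n (g : 'I_n -> R) (A : 'M[R]_n)
    (i : 'I_n) :
  g i * cofactor (\matrix_(r, s) (g r * A r s)) i i =
  (\prod_r g r) * cofactor A i i.
Proof.
case: n g A i => [|n] g A i; first by case: i.
have -> : \prod_r g r = g i * \prod_(r < n) g (lift i r).
  by rewrite (bigD1_ord i).
rewrite -mulrA; congr (_ * _); rewrite /cofactor mulrCA; congr (_ * _).
rewrite -det_scale_rows; congr (\det _); apply/matrixP=> r s.
by rewrite !mxE.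
Qed.

(** Sylvester's identity without division: the block matrix [D] is made triangular by column
    operations in two ways, one for each order of the product. *)
Lemma det_scalar_sub_mulmx (R : comNzRingType) n m (z : R) (A : 'M[R]_(n, m))
    (B : 'M[R]_(m, n)) :
  z ^+ m * \det (z%:M - A *m B) = z ^+ n * \det (z%:M - B *m A).
Proof.
pose D := block_mx z%:M A B 1%:M.
have DE : \det D = \det (z%:M - A *m B).
  have <- : \det (D *m block_mx 1%:M 0 (- B) 1%:M) = \det D.
    by rewrite det_mulmx det_lblock !det1 !mulr1.
  rewrite mulmx_block !mulmx1 !mulmx0 mulmxN mul1mx subrr !add0r det_ublock.
  by rewrite det1 mulr1.
rewrite -DE mulrC -[z ^+ m]det_scalar.
have <- : \det (block_mx 1%:M (- A) 0 z%:M) = \det (z%:M : 'M_m).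
  by rewrite det_ublock det1 mul1r.
rewrite -det_mulmx mulmx_block !mulmx1 !mulmx0 !addr0 mul1mx mulmxN.
by rewrite mul_scalar_mx mul_mx_scalar addNr mulmxN addrC det_lblock det_scalar.
Qed.

(* For an invertible [1 - A B] this is the push-through identity
   [(1 - A B)^-1 = 1 + A (1 - B A)^-1 B] multiplied by the determinant; the
   singular case follows by replacing [1] with an indeterminate. *)
Lemma adj_one_sub_mulmx (F : idomainType) n m (A : 'M[F]_(n, m))
    (B : 'M[F]_(m, n)) :
  \adj (1%:M - A *m B) =
  (\det (1%:M - B *m A))%:M + A *m \adj (1%:M - B *m A) *m B.
Proof.
pose A' := map_mx (@polyC F) A; pose B' := map_mx (@polyC F) B.
pose z : {poly F} := 'X.
pose M := z%:M - A' *m B'; pose N := z%:M - B' *m A'.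
pose S := (\det N)%:M + A' *m \adj N *m B'.
have NE : N = char_poly_mx (B *m A) by rewrite /char_poly_mx map_mxM.
have q_neq0 : \det N != 0.
  by rewrite NE; apply/monic_neq0/char_poly_monic.
have MA : M *m A' = A' *m N.
  by rewrite mulmxBl mulmxBr mul_scalar_mx mul_mx_scalar mulmxA.
have MS : M *m S = (z * \det N)%:M.
  rewrite mulmxDr mulmxA mulmxA MA -(mulmxA A') mul_mx_adj !mul_mx_scalar.
  by rewrite scalerBr -scalemxAl subrK scale_scalar_mx mulrC.
(* Both sides agree after scaling by [\det N], a monic polynomial in [z], hence cancellable. The
   powers of [z] disappear on evaluation at 1. *)
have key : z ^+ m.+1 *: \adj M = z ^+ n *: S.
  have e1 : (z * \det N) *: \adj M = \det M *: S.
    by rewrite -mul_mx_scalar -MS mulmxA mul_adj_mx mul_scalar_mx.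
  have e2 : \det N *: (z ^+ m.+1 *: \adj M) = \det N *: (z ^+ n *: S).
    have -> : \det N *: (z ^+ m.+1 *: \adj M) = z ^+ m *: ((z * \det N) *: \adj M).
      by rewrite !scalerA exprSr mulrC mulrA.
    rewrite e1 !scalerA.
    by rewrite (det_scalar_sub_mulmx z A' B') mulrC.
  apply/matrixP=> i j; apply: (mulfI q_neq0).
  by move/matrixP/(_ i j): e2; rewrite !mxE.
have ev p q (X : 'M[F]_(p, q)) : map_mx (horner_eval 1) (map_mx (@polyC F) X) = X.
  by apply/matrixP=> i j; rewrite !mxE horner_evalE hornerC.
have z1 : horner_eval (1 : F) z = 1 by rewrite horner_evalE hornerX.
have evM : map_mx (horner_eval 1) M = 1%:M - A *m B.
  by rewrite map_mxB map_scalar_mx map_mxM !ev /= z1.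
have evN : map_mx (horner_eval 1) N = 1%:M - B *m A.
  by rewrite map_mxB map_scalar_mx map_mxM !ev /= z1.
move/(congr1 (map_mx (horner_eval (1 : F)))): key.
rewrite !map_mxZ !rmorphXn /= z1 !expr1n !scale1r map_mx_adj evM => ->.
by rewrite map_mxD map_scalar_mx !map_mxM map_mx_adj !ev evN -det_map_mx evN.
Qed.

(** With both determinants 0, the adjugate is [A *m \adj N *m B] for [N := 1 - B A]. Cyclicity turns
    its trace into that of [(1 - N) *m \adj N], and [N *m \adj N = 0]. *)
Lemma tr_adj_one_sub_mulmx (F : idomainType) n m (A : 'M[F]_(n, m))
    (B : 'M[F]_(m, n)) :
  \det (1%:M - A *m B) = 0 ->
  \tr (\adj (1%:M - A *m B)) = \tr (\adj (1%:M - B *m A)).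
Proof.
move=> det0; have := det_scalar_sub_mulmx 1 A B.
rewrite !expr1n !mul1r det0 => /esym detN0.
rewrite adj_one_sub_mulmx detN0 raddf0 add0r mxtrace_mulC mulmxA.
move: detN0; set N := 1%:M - B *m A => detN0.
have -> : B *m A = 1%:M - N by rewrite opprB addrC subrK.
by rewrite mulmxBl mul1mx mul_mx_adj detN0 raddf0 subr0.
Qed.

(** * Closed walks and Whittle's formula *)

Lemma xvar_inj n (i j i' j' : 'I_n) :
  (xvar i j == xvar i' j') = (i == i') && (j == j').
Proof.
apply/eqP/andP => [|[/eqP-> /eqP->] //].
rewrite /xvar => e; have [] : (i, j) = (i', j').
  have [g fK _] := curry_mxvec_bij n n.
  by rewrite -[(i, j)](fK _ isT) -[(i', j')](fK _ isT) /= e.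
by move=> -> ->.
Qed.

Definition mfact n (c : 'X_{1..n}) : nat := (\prod_s (c s)`!)%N.

Lemma mfactDU n (c : 'X_{1..n}) (s : 'I_n) :
  mfact (c + U_(s)) = ((c s).+1 * mfact c)%N.
Proof.
rewrite /mfact (bigD1 s) //= [in RHS](bigD1 s) //= mulnA; congr (_ * _)%N.
  by rewrite mnmDE mnm1E eqxx addn1 factS.
by apply: eq_bigr => t /negbTE ts; rewrite mnmDE mnm1E eq_sym ts addn0.
Qed.

Section Walks.

Variables (C : numFieldType) (n : nat).
Implicit Types (c : 'X_{1..n * n}) (i j u v : 'I_n).

Definition outdeg c i : nat := (\sum_j c (xvar i j))%N.
Definition indeg c i : nat := (\sum_j c (xvar j i))%N.

(** The degree condition for the arcs of a walk from [u] to [v], written without subtraction.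
    Connectedness is detected by the adjugate in Whittle's formula. *)
Definition eulerian c u v :=
  [forall i, outdeg c i + (i == v) == indeg c i + (i == u)]%N.

(** A vertex of out-degree 0 has no arcs and its quotients are 0, so its row is that of the identity
    matrix. *)
Definition walk_laplacian c : 'M[C]_n :=
  \matrix_(i, j) ((i == j)%:R - (c (xvar i j))%:R / (outdeg c i)%:R).

Lemma arcDU c i j i' j' :
  (c + U_(xvar i j))%MM (xvar i' j') =
  (c (xvar i' j') + (i == i') && (j == j'))%N.
Proof. by rewrite mnmDE mnm1E xvar_inj. Qed.

Lemma outdegDU c i j i' :
  outdeg (c + U_(xvar i j)) i' = (outdeg c i' + (i' == i))%N.
Proof.
rewrite /outdeg (eq_bigr _ (fun s _ => arcDU c i j i' s)) big_split /=.
congr (_ + _)%N; rewrite (bigD1 j) //= eqxx andbT big1 ?addn0 1?eq_sym //.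
by move=> s; rewrite eq_sym => /negbTE ->; rewrite andbF.
Qed.

Lemma indegDU c i j j' :
  indeg (c + U_(xvar i j)) j' = (indeg c j' + (j' == j))%N.
Proof.
rewrite /indeg (eq_bigr _ (fun s _ => arcDU c i j s j')) big_split /=.
congr (_ + _)%N; rewrite (bigD1 i) //= eqxx big1 ?addn0 1?eq_sym //.
by move=> s; rewrite eq_sym => /negbTE ->.
Qed.

Lemma eulerianDU c u v j :
  eulerian (c + U_(xvar j v)) u v = eulerian c u j.
Proof.
apply: eq_forallb => i; rewrite outdegDU indegDU [X in _ == X]addnAC.
by rewrite eqn_add2r.
Qed.

Lemma mdeg_outdeg c : mdeg c = (\sum_i outdeg c i)%N.
Proof.
rewrite mdegE /outdeg pair_bigA /=.
rewrite (reindex (uncurry (@mxvec_index n n))) /=; last exact: curry_mxvec_bij.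
by apply: eq_bigr => -[i j].
Qed.

Lemma outdeg_fact_DU c i j :
  (\prod_s (outdeg (c + U_(xvar i j)) s)`! =
   (outdeg c i).+1 * \prod_s (outdeg c s)`!)%N.
Proof.
rewrite (bigD1 i) //= [in RHS](bigD1 i) //= mulnA; congr (_ * _)%N.
  by rewrite outdegDU eqxx addn1 factS.
by apply: eq_bigr => t /negbTE ts; rewrite outdegDU ts addn0.
Qed.

(** By balance, the vector of out-degrees is stationary, hence a nonzero vector in the left
    kernel. *)
Lemma det_walk_laplacian c u :
  (0 < mdeg c)%N -> eulerian c u u -> \det (walk_laplacian c) = 0.
Proof.
move=> c_gt0 /forallP bal; apply/eqP/det0P.
exists (\row_i (outdeg c i)%:R).
  apply/eqP=> /rowP d0; move: c_gt0; rewrite mdeg_outdeg big1 // => i _.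
  by move/eqP: (d0 i); rewrite !mxE pnatr_eq0 => /eqP.
apply/rowP=> j; rewrite !mxE.
have arcE i : (outdeg c i)%:R * ((c (xvar i j))%:R / (outdeg c i)%:R) =
              (c (xvar i j))%:R :> C.
  have [d0|dn0] := eqVneq (outdeg c i) 0%N; last first.
    by rewrite mulrC divfK // pnatr_eq0.
  move/eqP: (d0); rewrite sum_nat_eq0 => /forallP/(_ j)/eqP ->.
  by rewrite mul0r mulr0.
transitivity (\sum_i ((outdeg c i)%:R * (i == j)%:R - (c (xvar i j))%:R) : C).
  by apply: eq_bigr => i _; rewrite !mxE mulrBr arcE.
rewrite big_split /= sumrN (bigD1 j) //= eqxx mulr1 big1 => [|i /negbTE->].
  move/(_ j): bal; rewrite eqn_add2r => /eqP->.
  by rewrite addr0 -natr_sum subrr.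
by rewrite mulr0.
Qed.

Lemma adj_walk_laplacianDU c u v j :
  \adj (walk_laplacian (c + U_(xvar j v))) u j = \adj (walk_laplacian c) u j.
Proof.
rewrite !mxE; apply: cofactor_eq_off_row => i /negbTE ij s.
by rewrite !mxE arcDU outdegDU eq_sym ij /= ?[_ == i]eq_sym ?ij !addn0 eq_sym.
Qed.

Lemma mcoeffMU (p : {mpoly C[n * n]}) c s :
  (p * 'X_s)@_c = if (0 < c s)%N then p@_(c - U_(s)) else 0.
Proof.
case: ifPn => [cs|cs].
  rewrite -[in LHS](@submK _ U_(s) c) ?[(_ + U_(s))%MM]addmC ?mcoeffMX //.
  by rewrite lep1mP -lt0n.
have: c \notin msupp (p * 'X_s).
  rewrite (perm_mem (msuppMX p U_(s))); apply/mapP => -[c' _ cE].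
  by move: cs; rewrite cE mnmDE mnm1E eqxx.
by move/memN_msupp_eq0.
Qed.

(* Whittle's formula.  Removing the last arc [j -> v] of a walk only changes
   row [j] of the Laplacian, which is the row deleted in the cofactor for
   walks from [u] to [j]. *)
Lemma mcoeff_generic_mxX N u v c :
  (mfact c)%:R * ((generic_mx C n ^+ N) u v)@_c =
  if (mdeg c == N) && eulerian c u v
  then (\prod_i (outdeg c i)`!)%:R * \adj (walk_laplacian c) u v else 0.
Proof.
elim: N u v c => [|N IHN] u v c.
  rewrite expr0 [(1 : 'M__) u v]mxE mdeg_eq0 mcoeffMn mcoeff1.
  have [->|c0] := eqVneq c 0%MM; last by rewrite mul0rn mulr0.
  have out0 i : outdeg 0%MM i = 0%N by apply: big1 => j _; rewrite mnm0E.
  have -> : mfact (0%MM : 'X_{1..n * n}) = 1%N.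
    by apply: big1 => s _; rewrite mnm0E.
  rewrite big1 => [|i _]; last by rewrite out0.
  have -> : walk_laplacian 0%MM = 1%:M.
    by apply/matrixP=> i j; rewrite !mxE out0 mnm0E mul0r subr0.
  have -> : eulerian 0%MM u v = (u == v).
    apply/forallP/eqP => [/(_ u)|-> i].
      rewrite out0 [indeg _ _]big1 => [|j _]; last by rewrite mnm0E.
      by rewrite eqxx !add0n; case: (u =P v).
    by rewrite out0 [indeg _ _]big1 => [|j _]; rewrite ?mnm0E.
  by rewrite adj1 !mxE mul1r /=; case: eqP; rewrite ?mulr1 ?mulr0.
have -> : (generic_mx C n ^+ N.+1) u v =
    \sum_j (generic_mx C n ^+ N) u j * generic_mx C n j v.
  by rewrite exprSr mxE.
rewrite raddf_sum mulr_sumr /=.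
pose good := (mdeg c == N.+1) && eulerian c u v.
pose D : C := (\prod_i (outdeg c i)`!)%:R.
have step j : (mfact c)%:R * ((generic_mx C n ^+ N) u j * generic_mx C n j v)@_c =
    if good then D * (\adj (walk_laplacian c) u j *
                      ((c (xvar j v))%:R / (outdeg c j)%:R)) else 0.
  rewrite [generic_mx _ _ j v]mxE mcoeffMU; case: posnP => [->|c_gt0].
    by rewrite mul0r !mulr0 if_same.
  have cE : (c - U_(xvar j v) + U_(xvar j v))%MM = c.
    by rewrite submK // lep1mP -lt0n.
  rewrite /good /D; move: (c - _)%MM cE => c' <-.
  rewrite mfactDU natrM -mulrA IHN mdegD mdeg1 addn1 eqSS eulerianDU.
  case: ifP => _; last by rewrite mulr0.
  rewrite outdeg_fact_DU adj_walk_laplacianDU outdegDU arcDU !eqxx !addn1 natrM.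
  have d_neq0 : (outdeg c' j).+1%:R != 0 :> C by rewrite pnatr_eq0.
  move: {+}(\adj _ u j : C) d_neq0 => e; move: (_.+1%:R) => f f_neq0.
  by field.
rewrite (eq_bigr _ (fun j _ => step j)) -/good -/D.
case: ifPn => [/andP[/eqP degc bal]|_]; last by rewrite big1.
rewrite -mulr_sumr; congr (_ * _).
(* The recursion on the last arc closes because this product vanishes at [u], [v]: it is scalar, and
   for [u = v] its diagonal value is the determinant of a balanced Laplacian. *)
have adj_lap : (\adj (walk_laplacian c) *m walk_laplacian c) u v = 0.
  rewrite mul_adj_mx mxE; case: eqP => // uv.
  by rewrite (@det_walk_laplacian c u) ?degc // {2}uv.
have colE : \adj (walk_laplacian c) u v =
    \sum_j \adj (walk_laplacian c) u j * (j == v)%:R.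
  by rewrite (bigD1 v) //= eqxx mulr1 big1 ?addr0 // => j /negbTE->; rewrite mulr0.
apply/esym/eqP; rewrite -subr_eq0 colE -sumrB -[X in _ == X]adj_lap.
rewrite [X in _ == X]mxE; apply/eqP/eq_bigr => j _.
by rewrite [walk_laplacian c j v]mxE mulrBr.
Qed.

End Walks.

(** * The trace as a differential operator *)

Section DiffOp.

Variables (R : comNzRingType) (n : nat).
Implicit Types (p q : {mpoly R[n]}) (m : 'X_{1..n}).

(** The constant-coefficient operator with symbol [q]: each variable acts as its derivative, so
    products of symbols become compositions. *)
Definition diffop q p : {mpoly R[n]} := \sum_(m <- msupp q) q@_m *: p^`M[m].

(** A common finite range of monomials, so that the sums for different symbols can be added
    termwise. *)
Lemma diffop_wE s q p : (msize q <= s)%N ->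
  diffop q p = \sum_(m : 'X_{1..n < s}) q@_m *: p^`M[m].
Proof.
move=> le_qs; pose I : subFinType _ := 'X_{1..n < s}.
rewrite /diffop (big_mksub I) ?msupp_uniq //=; last first.
  by move=> m /msize_mdeg_lt /leq_trans; apply.
by rewrite big_rmcond //= => m /memN_msupp_eq0 ->; rewrite scale0r.
Qed.

Lemma diffop_linear p : linear (diffop ^~ p).
Proof.
move=> c q q'; pose s := maxn (msize (c *: q + q')) (maxn (msize q) (msize q')).
rewrite !(@diffop_wE s) ?leq_max ?leqnn ?orbT // scaler_sumr -big_split /=.
by apply: eq_bigr => m _; rewrite mcoeffD mcoeffZ scalerDl scalerA.
Qed.

Lemma diffop0 p : diffop 0 p = 0.
Proof. by rewrite /diffop msupp0 big_nil. Qed.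

Lemma diffopD q q' p : diffop (q + q') p = diffop q p + diffop q' p.
Proof. by have := diffop_linear p 1 q q'; rewrite !scale1r. Qed.

Lemma diffopZ c q p : diffop (c *: q) p = c *: diffop q p.
Proof. by have := diffop_linear p c q 0; rewrite diffop0 !addr0. Qed.

Lemma diffop_sum (I : Type) (r : seq I) (P : pred I) (F : I -> {mpoly R[n]}) p :
  diffop (\sum_(i <- r | P i) F i) p = \sum_(i <- r | P i) diffop (F i) p.
Proof.
apply: (big_morph (diffop^~ p)) => [q q'|]; [exact: diffopD | exact: diffop0].
Qed.

Lemma diffopX m p : diffop 'X_[m] p = p^`M[m].
Proof. by rewrite /diffop msuppX big_seq1 mcoeffX eqxx scale1r. Qed.

Lemma diffop1 p : diffop 1 p = p.
Proof.
rewrite -mpolyX0 diffopX /mderivm.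
by elim: (enum _) => //= i s ->; rewrite mnm0E.
Qed.

Lemma diffopM q q' p : diffop (q * q') p = diffop q (diffop q' p).
Proof.
elim/mpolyind: q => [|c m q _ _ IHq]; first by rewrite mul0r !diffop0.
rewrite mulrDl !diffopD {}IHq; congr (_ + _).
rewrite -scalerAl !diffopZ; congr (_ *: _).
elim/mpolyind: q' => [|c' m' q' _ _ IHq'].
  by rewrite mulr0 diffop0 diffopX linear0.
rewrite mulrDr -scalerAr !diffopD !diffopZ IHq' !diffopX linearD linearZ /=.
by rewrite -mpolyXD diffopX addmC mderivmDm.
Qed.

Lemma diffop_exp q s p : diffop (q ^+ s) p = iter s (diffop q) p.
Proof.
by elim: s p => [|s IHs] p; rewrite ?expr0 ?diffop1 // exprS diffopM IHs.
Qed.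

Lemma diffop_prod (I : Type) (r : seq I) (F : I -> {mpoly R[n]}) p :
  diffop (\prod_(i <- r) F i) p = (\big[comp/id]_(i <- r) diffop (F i)) p.
Proof.
elim: r p => [|i r IHr] p; rewrite ?big_nil ?diffop1 //.
by rewrite !big_cons diffopM IHr.
Qed.

End DiffOp.

Section TensorDiff.

Variables (C : fieldType) (n k : nat) (T : tensor C k n).

Definition star_mnm (i : 'I_n) (l : seq 'I_n) : 'X_{1..n * n} :=
  (\big[mnm_add/mnm0]_(j <- l) mnm1 (xvar i j))%MM.

Definition tensor_symbol (i : 'I_n) : {mpoly C[n * n]} :=
  \sum_(l : k.-1.-tuple 'I_n) T i l *: 'X_[star_mnm i l].

Lemma partial_rowE i l (p : {mpoly C[n * n]}) :
  partial_row i l p = p^`M[star_mnm i l].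
Proof.
rewrite /star_mnm; elim: l => [|j l IHl] /=.
  by rewrite big_nil -[RHS]diffopX mpolyX0 diffop1.
by rewrite big_cons IHl addmC mderivmDm mderivmU1m.
Qed.

Lemma tensor_diffE i p : tensor_diff T i p = diffop (tensor_symbol i) p.
Proof.
rewrite diffop_sum; apply: eq_bigr => l _.
by rewrite diffopZ diffopX partial_rowE.
Qed.

Lemma tensor_traceE d :
  tensor_trace d T = (k.-1)%:R ^+ n.-1 *
    \sum_(a : {ffun 'I_n -> 'I_d.+1} | (\sum_i a i)%N == d)
      diffop (\prod_i (((a i * k.-1)`!)%:R^-1 *: tensor_symbol i ^+ a i))
        (\tr (generic_mx C n ^+ (d * k.-1))).
Proof.
congr (_ * _); apply: eq_bigr => a _; rewrite diffop_prod.
elim: (index_enum _) (\tr _) => [|i r IHr] p; rewrite ?big_nil // !big_cons /=.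
rewrite diffopZ diffop_exp IHr; congr (_ *: _).
by elim: {IHr} (nat_of_ord _) => //= s ->; rewrite tensor_diffE.
Qed.

End TensorDiff.

(** * Derivatives of the closed walk polynomial *)

Section TraceCoefficient.

Variables (C : numFieldType) (n : nat).

Definition balanced (c : 'X_{1..n * n}) := [forall i, outdeg c i == indeg c i].

Lemma eulerian_closed (c : 'X_{1..n * n}) u : eulerian c u u = balanced c.
Proof. by apply: eq_forallb => i; rewrite eqn_add2r. Qed.

Lemma mderivm_tr_generic_mxX N (c : 'X_{1..n * n}) : mdeg c = N ->
  (\tr (generic_mx C n ^+ N))^`M[c] =
  (if balanced c
   then (\prod_i (outdeg c i)`!)%:R * \tr (\adj (walk_laplacian C c))
   else 0)%:MP.
Proof.
move=> degc; apply/mpolyP => m; rewrite mcoeff_mderivm mcoeffC.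
have trE (c' : 'X_{1..n * n}) : (mfact c')%:R * (\tr (generic_mx C n ^+ N))@_c' =
    if (mdeg c' == N) && balanced c'
    then (\prod_i (outdeg c' i)`!)%:R * \tr (\adj (walk_laplacian C c')) else 0.
  rewrite raddf_sum mulr_sumr /=.
  under eq_bigr => u _ do rewrite mcoeff_generic_mxX eulerian_closed.
  by case: ifP => _; [rewrite -mulr_sumr | rewrite big1].
have [->|m0] := eqVneq m 0%MM.
  have := trE c; rewrite degc eqxx /= addm0 mulr1 => <-.
  rewrite -[LHS]mulr_natl; congr (_ * _); congr _%:R.
  by apply: eq_bigr => s _; rewrite ffactnn.
(* The monomial [c + m] has degree above [N], so its coefficient times a nonzero product of
   factorials is 0. *)
rewrite mulr0; have /eqP := trE (c + m)%MM.
rewrite mdegD degc -[X in (_ == X) && _]addn0 eqn_add2l mdeg_eq0 (negbTE m0) /=.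
rewrite mulf_eq0 => /orP[|/eqP->]; last by rewrite mul0rn.
rewrite pnatr_eq0 -leqn0 leqNgt => /negP[].
by apply: prodn_gt0 => s; apply: fact_gt0.
Qed.

End TraceCoefficient.

(** * Random walks on weighted hypergraphs *)

Lemma one_sub_mxE (R : pzRingType) n (A : 'M[R]_n) i j :
  (1%:M - A) i j = (i == j)%:R - A i j.
Proof. by rewrite !mxE. Qed.

Section HypergraphWalk.

Variables (C : numFieldType) (n m k : nat) (E : 'I_m -> {set 'I_n}).
Variables (w : 'I_m -> nat) (c : 'X_{1..n * n}).
Hypothesis k_gt1 : (1 < k)%N.
Hypothesis cardE : forall e, #|E e| = k.
Hypothesis cE : forall u v,
  c (xvar u v) = ((u != v) * \sum_(e | (u \in E e) && (v \in E e)) w e)%N.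

Definition vdeg (u : 'I_n) : nat := (\sum_(e | u \in E e) w e)%N.

(** The two half-steps of the walk: from a vertex to an incident edge with probability proportional
    to its weight, then to a uniform vertex of that edge, possibly the same one. *)
Definition vertex_edge_mx : 'M[C]_(n, m) :=
  \matrix_(u, e) ((u \in E e)%:R * (w e)%:R / (vdeg u)%:R).

Definition edge_vertex_mx : 'M[C]_(m, n) := \matrix_(e, u) ((u \in E e)%:R / k%:R).

Let k_neq0 : k%:R != 0 :> C. Proof. by rewrite pnatr_eq0; lia. Qed.
Let k1_neq0 : k.-1%:R != 0 :> C. Proof. by rewrite pnatr_eq0; lia. Qed.

Lemma outdeg_hypergraph u : outdeg c u = (vdeg u * k.-1)%N.
Proof.
rewrite /outdeg /vdeg big_distrl /=.
under eq_bigr => v _ do rewrite cE big_distrr /= big_mkcondr /=.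
rewrite exchange_big /=; apply: eq_bigr => e ue.
rewrite -big_mkcond /= -big_distrl /= mulnC; congr (_ * _)%N.
rewrite -(cardE e) (cardD1 u) ue add1n /= -sum1_card big_mkcond [RHS]big_mkcond.
by apply: eq_bigr => v _; rewrite !inE eq_sym; case: (v == u); case: (v \in E e).
Qed.

Lemma vertex_edge_vertexE u v :
  (vertex_edge_mx *m edge_vertex_mx) u v =
  (\sum_(e | (u \in E e) && (v \in E e)) w e)%:R / (vdeg u)%:R / k%:R.
Proof.
rewrite !mxE natr_sum !mulr_suml [RHS]big_mkcond; apply: eq_bigr => e _.
rewrite !mxE; case: (u \in E e); case: (v \in E e);
  by rewrite /= ?(mul0r, mulr0, mul1r).
Qed.

Let g u : C := if vdeg u == 0%N then 1 else k%:R / k.-1%:R.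

(** The two-step walk stays put with probability [1 / k], whereas the arcs have no loops.
    Conditioning on a move rescales the row by [k / (k - 1)]; on a vertex of degree 0 both rows are
    those of the identity. *)
Lemma walk_laplacianE :
  walk_laplacian C c =
  \matrix_(u, v) (g u * (1%:M - vertex_edge_mx *m edge_vertex_mx) u v).
Proof.
apply/matrixP => u v; rewrite [LHS]mxE [RHS]mxE one_sub_mxE vertex_edge_vertexE.
rewrite outdeg_hypergraph cE /g.
have [->|d0] := eqVneq (vdeg u) 0%N; first by rewrite mul0n invr0 !mulr0 mul0r mul1r.
have d_neq0 : (vdeg u)%:R != 0 :> C by rewrite pnatr_eq0.
have kE : k%:R = k.-1%:R + 1 :> C by rewrite natr1 prednK //; lia.
rewrite natrM; have [uv|uv] := eqVneq u v; last first.
  rewrite /= mul1r natrM !sub0r kE; field.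
  by rewrite -?kE d_neq0 k1_neq0 k_neq0.
rewrite -uv /= !mul0r subr0; under eq_bigl => e do rewrite andbb.
rewrite -/(vdeg u) kE; field.
by rewrite -?kE d_neq0 k1_neq0 k_neq0.
Qed.

Hypothesis w_neq0 : exists e, w e != 0%N.

(** The degree vector is stationary: the first half-step sends it to [k * w e] on the edges, the
    second one back. *)
Lemma det_one_sub_vertex_edge :
  \det (1%:M - vertex_edge_mx *m edge_vertex_mx) = 0.
Proof.
apply/eqP/det0P; exists (\row_u (vdeg u)%:R).
  have [e we] := w_neq0; apply/eqP => /rowP d0.
  have [u ue] : exists u, u \in E e by apply/card_gt0P; rewrite cardE; lia.
  move/eqP: (d0 u); rewrite !mxE pnatr_eq0 sum_nat_eq0 => /forallP/(_ e).
  by rewrite ue (negbTE we).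
rewrite mulmxBr mulmx1 mulmxA; apply/eqP; rewrite subr_eq0; apply/eqP.
have -> : (\row_u (vdeg u)%:R : 'rV[C]_n) *m vertex_edge_mx = \row_e (k * w e)%:R.
  apply/rowP => e; rewrite !mxE -(cardE e) -sum1_card natrM natr_sum mulr_suml.
  rewrite [RHS]big_mkcond; apply: eq_bigr => u _; rewrite !mxE.
  case: ifP => ue; last by rewrite !mul0r mulr0.
  rewrite !mul1r; have [d0|d0] := eqVneq (vdeg u) 0%N.
    move/eqP: (d0); rewrite sum_nat_eq0 => /forallP/(_ e).
    by rewrite ue d0 => /eqP->; rewrite mul0r.
  by rewrite mulrC divfK // pnatr_eq0.
apply/rowP => v; rewrite !mxE natr_sum big_mkcond; apply: eq_bigr => e _.
rewrite !mxE; case: ifP => _; last by rewrite mul0r mulr0.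
by rewrite mul1r natrM mulrAC divff // mul1r.
Qed.

(** Each principal cofactor at a used vertex loses one of the row factors, which explains the
    predecessor in the exponent. *)
Lemma tr_adj_walk_laplacian :
  \tr (\adj (walk_laplacian C c)) =
  (k%:R / k.-1%:R) ^+ #|[set u | vdeg u != 0%N]|.-1 *
  \tr (\adj (1%:M - edge_vertex_mx *m vertex_edge_mx)).
Proof.
have det0 := det_one_sub_vertex_edge.
rewrite -tr_adj_one_sub_mulmx // walk_laplacianE /mxtrace mulr_sumr.
set K := 1%:M - _ in det0 *; apply: eq_bigr => u _.
have -> : (\adj K) u u = cofactor K u u by rewrite mxE.
have -> : (\adj (\matrix_(u, v) (g u * K u v))) u u =
  cofactor (\matrix_(u, v) (g u * K u v)) u u by rewrite mxE.
have gr : k%:R / k.-1%:R != 0 :> C by rewrite mulf_neq0 // invr_eq0.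
have g_neq0 : g u != 0 by rewrite /g; case: ifP => _ //; apply: oner_neq0.
apply: (mulfI g_neq0); rewrite cofactor_scale_rows [RHS]mulrA.
have -> : \prod_r g r = (k%:R / k.-1%:R) ^+ #|[set u | vdeg u != 0%N]|.
  rewrite -prodr_const [RHS]big_mkcond; apply: eq_bigr => v _.
  by rewrite inE /g; case: ifP.
rewrite [g u]/g; case: ifP => du; last first.
  by rewrite -exprS prednK //; apply/card_gt0P; exists u; rewrite inE du.
suff -> : cofactor K u u = 0 by rewrite !mulr0.
have : (K *m \adj K) u u = 0 by rewrite mul_mx_adj det0 mxE mul0rn.
have row0 v : K u v = (u == v)%:R.
  rewrite one_sub_mxE mxE big1 ?subr0 // => e _.
  by rewrite !mxE (eqP du) invr0 mulr0 mul0r.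
rewrite mxE (bigD1 u) //= row0 eqxx mul1r big1 => [|v /negbTE vu]; last first.
  by rewrite row0 eq_sym vu mul0r.
by rewrite addr0 mxE.
Qed.

End HypergraphWalk.

(** * The symbol of the adjacency tensor *)

Section AdjacencySymbol.

Variables (C : numFieldType) (n k : nat) (H : {set {set 'I_n}}).
Hypothesis k_gt0 : (0 < k)%N.
Hypothesis unifH : uniform_hypergraph k H.

Definition edge_mnm (v : 'I_n) (e : {set 'I_n}) : 'X_{1..n * n} :=
  (\big[mnm_add/mnm0]_(j in e :\ v) mnm1 (xvar v j))%MM.

Lemma edge_mnmE v e u j :
  edge_mnm v e (xvar u j) = [&& u == v, j != v & j \in e] :> nat.
Proof.
rewrite mnm_sumE; have [uv|uv] := boolP [&& u == v, j != v & j \in e].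
  case/and3P: uv => /eqP-> jv je.
  rewrite (bigD1 j) /=; last by rewrite !inE jv.
  rewrite mnm1E eqxx big1 // => i /andP[_ /negbTE ij].
  by rewrite mnm1E xvar_inj ij andbF.
apply: big1 => i; rewrite !inE mnm1E xvar_inj => /andP[iv ie].
apply/eqP; rewrite eqb0; apply: contra uv => /andP[/eqP<- /eqP<-].
by rewrite eqxx iv ie.
Qed.

Lemma seq_edgeP (v : 'I_n) e (l : k.-1.-tuple 'I_n) : e \in H -> v \in e ->
  ([set x in v :: l] == e) = all (mem (e :\ v)) l && uniq l.
Proof.
move=> He ve; have sz : size (v :: l) = k by rewrite /= size_tuple prednK.
apply/eqP/andP => [eE|[/allP le ul]].
  have /andP[vl ul] : uniq (v :: l).
    by apply/card_uniqP; rewrite sz -[RHS](unifH He) -eE cardsE.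
  split=> //; apply/allP => x xl.
  rewrite inE in_setD1 -eE inE inE xl orbT andbT.
  by apply: contraNneq vl => <-.
apply/eqP; rewrite eqEcard (unifH He) cardsE; apply/andP; split.
  apply/subsetP => x; rewrite !inE => /orP[/eqP->//|/le].
  by rewrite inE in_setD1 => /andP[].
rewrite (card_uniqP _) ?sz //= ul andbT.
by apply/negP => /le; rewrite inE in_setD1 eqxx.
Qed.

(** An edge through [v] arises from the [(k - 1)!] orderings of its other vertices, which cancels
    the entry [1 / (k - 1)!]. *)
Lemma adjacency_symbol (v : 'I_n) :
  tensor_symbol (adjacency_tensor C k H) v =
  \sum_(e in H | v \in e) 'X_[edge_mnm v e].
Proof.
rewrite /tensor_symbol /adjacency_tensor.
rewrite (bigID (fun l : k.-1.-tuple 'I_n => [set x in v :: l] \in H)) /=.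
rewrite [X in _ + X]big1 ?addr0 => [|l /negbTE->]; last by rewrite scale0r.
rewrite (partition_big (fun l : k.-1.-tuple 'I_n => [set x in v :: l])
  (fun e => (e \in H) && (v \in e))) /=; last first.
  by move=> l ->; rewrite !inE eqxx.
apply: eq_bigr => e /andP[He ve].
transitivity (\sum_(l : k.-1.-tuple 'I_n | all (mem (e :\ v)) l && uniq l)
    (k.-1`!)%:R^-1 *: 'X_[edge_mnm v e] : {mpoly C[n * n]}).
  apply: eq_big => [l|l /andP[-> /eqP eE]].
    rewrite -(seq_edgeP l He ve); case: eqP => [->|_]; last by rewrite andbF.
    by rewrite He.
  have /andP[/allP le ul] : all (mem (e :\ v)) l && uniq l.
    by rewrite -seq_edgeP ?eE.
  congr (_ *: 'X_[_]); rewrite /star_mnm big_uniq //=.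
  apply: eq_bigl => x; rewrite -eE !inE.
  have vl : v \notin l by apply/negP => /le; rewrite inE in_setD1 eqxx.
  by case: eqVneq => //= ->; rewrite (negbTE vl).
have cardl :
    #|[set l : k.-1.-tuple 'I_n | all (mem (e :\ v)) l & uniq l]| = (k.-1)`!.
  rewrite card_uniq_tuples; have := unifH He; rewrite (cardsD1 v) ve add1n => <-.
  exact: ffactnn.
rewrite sumr_const.
rewrite cardsE in cardl; rewrite cardl -scaler_nat scalerA divff ?scale1r //.
by rewrite pnatr_eq0 -lt0n fact_gt0.
Qed.

End AdjacencySymbol.

(** * Hypercycles *)

Section Hypercycle.

Variables (m k : nat).
Hypothesis m_gt1 : (1 < m)%N.
Hypothesis k_gt2 : (2 < k)%N.

Local Notation V := 'I_(m * k.-1).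
Local Notation E := (@hypercycle_edge m k).

Lemma own_subproof (v : V) : (v %/ k.-1 < m)%N.
Proof. by rewrite ltn_divLR // -ltnS prednK; lia. Qed.

(* Each vertex lies on the edge [own v]; the joints are the vertices that also
   lie on the preceding edge [ord_pred (own v)]. *)
Definition own (v : V) : 'I_m := Ordinal (own_subproof v).

Definition joint (v : V) : bool := (v %% k.-1 == 0)%N.

Lemma mem_hypercycle_edge q v :
  (v \in E q) = (own v == q) || joint v && (own v == ordS q).
Proof.
have p_gt0 : (0 < k.-1)%N by lia.
have vE := divn_eq v k.-1; have vp := ltn_pmod v p_gt0.
have qN : (q * k.-1 + k.-1 <= m * k.-1)%N.
  by rewrite -mulSnr leq_mul2r ltn_ord orbT.
rewrite inE; apply/existsP/orP => [[t /eqP vt]|[/eqP <-|]].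
- have [tp|tp] := ltnP t k.-1.
    left; apply/eqP/val_inj; rewrite /= vt modn_small; last by lia.
    by rewrite divnMDl // divn_small ?addn0.
  have tE : t = k.-1 :> nat by have := ltn_ord t; lia.
  right; rewrite /joint vt tE -mulSnr -muln_modl modnMl eqxx /=.
  by apply/eqP/val_inj; rewrite /= vt tE -mulSnr -muln_modl mulnK.
- have tk : (v %% k.-1 < k)%N by lia.
  by exists (Ordinal tk); rewrite /= -vE modn_small.
case/andP=> /eqP jv /eqP/(congr1 val) /= ov.
have tk : (k.-1 < k)%N by lia.
exists (Ordinal tk); rewrite /= -mulSnr -muln_modl -ov.
by apply/eqP; rewrite [LHS]vE jv addn0.
Qed.

Lemma ordS_neq (q : 'I_m) : ordS q != q.
Proof.
apply/eqP => /(congr1 val) /=; have := ltn_ord q; have [|qm] := ltnP q.+1 m.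
  by move=> ? _; rewrite modn_small //; lia.
move=> qlt; have qE : q.+1 = m by lia.
by rewrite qE modnn => q0; lia.
Qed.

Lemma vtx_subproof (q : 'I_m) (r : 'I_k.-1) : (q * k.-1 + r < m * k.-1)%N.
Proof.
have : (q * k.-1 + k.-1 <= m * k.-1)%N by rewrite -mulSnr leq_mul2r ltn_ord orbT.
by have := ltn_ord r; lia.
Qed.

Definition vtx (q : 'I_m) (r : 'I_k.-1) : V := Ordinal (vtx_subproof q r).

Lemma own_vtx q r : own (vtx q r) = q.
Proof.
apply: val_inj; rewrite /= divnMDl ?divn_small ?addn0 //; first by lia.
Qed.

Lemma joint_vtx q r : joint (vtx q r) = (r == 0 :> nat).
Proof. by rewrite /joint /= modnMDl modn_small. Qed.

Lemma big_vtx (R : Type) (idx : R) (op : Monoid.com_law idx) (F : V -> R) :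
  \big[op/idx]_v F v = \big[op/idx]_q \big[op/idx]_r F (vtx q r).
Proof.
have p_gt0 : (0 < k.-1)%N by lia.
rewrite pair_bigA /= (reindex (fun x => vtx x.1 x.2)) //=.
exists (fun v => (own v, Ordinal (ltn_pmod v p_gt0))) => [[q r] _|v _] /=.
  by rewrite own_vtx; congr (_, _); apply: val_inj; rewrite /= modnMDl modn_small.
by apply: val_inj; rewrite /= -divn_eq.
Qed.

Lemma big_mem_edge (R : nmodType) (F : 'I_m -> R) v :
  \sum_(q | v \in E q) F q =
  F (own v) + (if joint v then F (ord_pred (own v)) else 0).
Proof.
rewrite (bigD1 (own v)) ?mem_hypercycle_edge ?eqxx //=; congr (_ + _).
have pq : ord_pred (own v) != own v.
  by apply: contra (ordS_neq (ord_pred (own v))) => /eqP e; rewrite ord_predK e.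
case: ifP => jv.
  rewrite (big_pred1 (ord_pred (own v))) // => q /=.
  rewrite mem_hypercycle_edge jv /=.
  have -> : (own v == ordS q) = (q == ord_pred (own v)).
    by rewrite -[RHS](can_eq (@ordSK _)) ord_predK eq_sym.
  case: (q =P ord_pred (own v)) => [->|_]; first by rewrite orbT pq.
  by rewrite orbF eq_sym andbN.
by apply: big1 => q; rewrite mem_hypercycle_edge jv orbF eq_sym andbN.
Qed.

Let p_gt0 : (0 < k.-1)%N. Proof. by lia. Qed.
Let p_gt1 : (1 < k.-1)%N. Proof. by lia. Qed.

(** The first vertex is the joint shared with the preceding edge. The second one exists because
    [k > 2] and lies on the edge [q] only, so it identifies [q]. *)
Definition first_vtx (q : 'I_m) : V := vtx q (Ordinal p_gt0).
Definition core_vtx (q : 'I_m) : V := vtx q (Ordinal p_gt1).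

Lemma hypercycle_edge_inj : injective E.
Proof.
move=> q q' /setP/(_ (core_vtx q)).
by rewrite !mem_hypercycle_edge own_vtx joint_vtx eqxx /= orbF => /esym/eqP.
Qed.

Lemma card_hypercycle_edge q : #|E q| = k.
Proof. by apply: (@hypercycle_uniform m k) => //; [lia | apply: imset_f]. Qed.

Lemma sum_joint (R : nmodType) q (F : V -> R) :
  \sum_r (if joint (vtx q r) then F (vtx q r) else 0) = F (first_vtx q).
Proof.
rewrite (bigD1 (Ordinal p_gt0)) //= joint_vtx eqxx big1 ?addr0 // => r r0.
by rewrite joint_vtx ifN.
Qed.

Lemma hypercycle_symbol (C : numFieldType) (v : V) :
  tensor_symbol (adjacency_tensor C k (hypercycle m k)) v =
  'X_[edge_mnm v (E (own v))] +
  (if joint v then 'X_[edge_mnm v (E (ord_pred (own v)))] else 0).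
Proof.
have k_gt0 : (0 < k)%N by lia.
have k_gt1 : (1 < k)%N by lia.
rewrite adjacency_symbol //; last exact: hypercycle_uniform.
rewrite -(big_mem_edge (fun q => 'X_[edge_mnm v (E q)])) /hypercycle.
rewrite big_mkcondr big_imset => [|q q' _ _]; last exact: hypercycle_edge_inj.
by rewrite -big_mkcond.
Qed.

(* The vertex [u] is the tail of [a u] hyperarcs, of which [j u] follow the
   edge preceding [own u] and the others follow [own u]. *)
Definition hyperflow (a j : V -> nat) : 'X_{1..(m * k.-1) * (m * k.-1)} :=
  (\big[mnm_add/mnm0]_u
    (mnm_add (mnm_muln (edge_mnm u (E (own u))) (a u - j u))
     (mnm_muln (edge_mnm u (E (ord_pred (own u)))) (j u))))%MM.

(** A vertex that is not a joint lies on a single edge, so its second count must be 0. *)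
Definition admissible (a j : V -> nat) :=
  [forall u, (j u <= a u)%N && (joint u || (j u == 0))%N].

Lemma hyperflowE a j u v :
  hyperflow a j (xvar u v) =
  ((u != v) * ((a u - j u) * (v \in E (own u)) +
                j u * (v \in E (ord_pred (own u)))))%N.
Proof.
rewrite mnm_sumE (bigD1 u) //= big1 ?addn0 => [|s /negbTE su].
  rewrite mnmDE !mulmnE !edge_mnmE eqxx [v == u]eq_sym /=.
  by case: (u != v); rewrite ?mul1n //= 2?[(_ * (_ : bool))%N]mulnC.
by rewrite mnmDE !mulmnE !edge_mnmE [u == s]eq_sym su.
Qed.

Lemma outdeg_hyperflow a j u : admissible a j ->
  outdeg (hyperflow a j) u = (a u * k.-1)%N.
Proof.
move=> /forallP/(_ u)/andP[le_ja jj]; rewrite /outdeg.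
under eq_bigr => v _ do rewrite hyperflowE.
have deg q : u \in E q -> (\sum_v (u != v) * (v \in E q) = k.-1)%N.
  move=> uq; have := card_hypercycle_edge q.
  rewrite (cardsD1 u) uq add1n => cardk.
  transitivity #|E q :\ u|; last by apply: (congr1 predn cardk).
  rewrite -sum1_card [RHS]big_mkcond.
  apply: eq_bigr => v _; rewrite in_setD1 eq_sym.
  by case: (v == u); case: (v \in E q).
transitivity ((a u - j u) * (\sum_v (u != v) * (v \in E (own u))) +
   j u * (\sum_v (u != v) * (v \in E (ord_pred (own u)))))%N.
  by rewrite !big_distrr -big_split; apply: eq_bigr => v _ /=; ring.
rewrite deg; last by rewrite mem_hypercycle_edge eqxx.
case/orP: jj => [ju|/eqP->]; last by rewrite subn0 mul0n addn0.
rewrite deg; last by rewrite mem_hypercycle_edge ord_predK eqxx ju orbT.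
by rewrite -mulnDl subnK.
Qed.

(** * The trace as a sum over choices of hyperarcs *)

Section Trace.

Variable C : numFieldType.

(** The binomial expansion, over a range independent of [a] so that the product over the vertices
    distributes. Impossible choices get coefficient 0. *)
Lemma hypercycle_symbol_exp d (a : 'I_d.+1) (u : V) :
  tensor_symbol (adjacency_tensor C k (hypercycle m k)) u ^+ a =
  \sum_(j < d.+1) (if (j <= a)%N && (joint u || (j == 0 :> nat))
                   then 'C(a, j) else 0)%:R *:
    'X_[mnm_add (mnm_muln (edge_mnm u (E (own u))) (a - j))
                (mnm_muln (edge_mnm u (E (ord_pred (own u)))) j)].
Proof.
rewrite hypercycle_symbol exprDn.
rewrite (big_ord_widen d.+1 (fun j => (_ ^+ (a - j) * _ ^+ j) *+ 'C(a, j))) //.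
rewrite big_mkcond; apply: eq_bigr => j _ /=; rewrite ltnS.
case: ifP => ja /=; last by rewrite scale0r.
case: (joint u) => /=; last first.
  case: eqP => [->|/eqP j0]; last by rewrite expr0n (negbTE j0) mulr0 mul0rn scale0r.
  by rewrite mulr1 subn0 bin0 scale1r mulr1n mpolyXn mulm0n addm0.
by rewrite mpolyXD !mpolyXn scaler_nat.
Qed.

Lemma hypercycle_trace d :
  tensor_trace d (adjacency_tensor C k (hypercycle m k)) =
  (k.-1%:R ^+ (m * k.-1).-1 *
    \sum_(a : {ffun V -> 'I_d.+1} | (\sum_v a v)%N == d)
     \sum_(j : {ffun V -> 'I_d.+1} |
         admissible (fun u => a u) (fun u => j u) &&
         balanced (hyperflow (fun u => a u) (fun u => j u)))
       (\prod_v 'C(a v, j v))%:R *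
       \tr (\adj (walk_laplacian C (hyperflow (fun u => a u) (fun u => j u)))))%:MP.
Proof.
rewrite tensor_traceE [RHS]rmorphM rmorphXn rmorph_nat; congr (_ * _).
rewrite raddf_sum; apply: eq_bigr => a /eqP suma.
rewrite scaler_prod diffopZ.
rewrite (eq_bigr _ (fun u _ => hypercycle_symbol_exp (a u) u)).
rewrite bigA_distr_bigA diffop_sum scaler_sumr raddf_sum [RHS]big_mkcond.
apply: eq_bigr => j _ /=; rewrite scaler_prod diffopZ.
have -> : \prod_u 'X_[mnm_add (mnm_muln (edge_mnm u (E (own u))) (a u - j u))
    (mnm_muln (edge_mnm u (E (ord_pred (own u)))) (j u))] =
    'X_[hyperflow (fun u => a u) (fun u => j u)]
    :> {mpoly C[(m * k.-1) * (m * k.-1)]}.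
  by rewrite (big_morph _ (@mpolyXD _ _) (@mpolyX0 _ _)).
rewrite diffopX.
have [adm|nadm] := boolP (admissible (fun u => a u) (fun u => j u)); last first.
  move: nadm; rewrite negb_forall => /existsP[u /negbTE /= nu].
  by rewrite [X in _ *: (X *: _)](bigD1 u) //= nu mul0r scale0r scaler0.
have degN : mdeg (hyperflow (fun u => a u) (fun u => j u)) = (d * k.-1)%N.
  transitivity ((\sum_u a u) * k.-1)%N; last by rewrite suma.
  rewrite mdeg_outdeg big_distrl.
  by apply: eq_bigr => u _; rewrite outdeg_hyperflow.
rewrite mderivm_tr_generic_mxX //; case: ifP => _; last by rewrite !scaler0.
rewrite -!mul_mpolyC -!mpolyCM; congr (_%:MP); rewrite !natr_prod !mulrA.
(* The out-degree of [u] is [a u * k.-1], so Whittle's factorials cancel the normalisation and the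
   binomials remain. *)
congr (_ * _); rewrite mulrAC -big_split -[RHS]mul1r /=; congr (_ * _).
  apply: big1 => u _; rewrite outdeg_hyperflow // mulVf //.
  by rewrite pnatr_eq0 -lt0n fact_gt0.
by apply: eq_bigr => u _; rewrite (forallP adm u).
Qed.

End Trace.

(** * Balanced flows and edge weights *)

Section Flow.

Variable w : 'I_m -> nat.

(** These counts describe the flow in which every vertex of the edge [q] is the tail of exactly
    [w q] hyperarcs following [q]. *)
Definition weight_in (v : V) : nat := joint v * w (ord_pred (own v)).
Definition weight_deg (v : V) : nat := w (own v) + weight_in v.

Lemma admissible_weight : admissible weight_deg weight_in.
Proof.
apply/forallP => v; rewrite leq_addl /weight_in.
by case: (joint v); rewrite //= mul0n.
Qed.

Lemma vdeg_weight v : vdeg E w v = weight_deg v.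
Proof.
rewrite /vdeg (big_mem_edge w) /weight_deg /weight_in; congr addn.
by case: (joint v); rewrite ?mul1n ?mul0n.
Qed.

Lemma hyperflow_weight u v :
  hyperflow weight_deg weight_in (xvar u v) =
  ((u != v) * \sum_(q | (u \in E q) && (v \in E q)) w q)%N.
Proof.
rewrite hyperflowE addnK big_mkcondr.
rewrite (big_mem_edge (fun q => if v \in E q then w q else 0%N)).
congr (_ * _)%N; rewrite /weight_in; congr addn.
  by case: ifP; rewrite ?muln1 ?muln0.
by case: (joint u); case: (v \in _); rewrite ?mul1n ?muln1 ?muln0 ?mul0n.
Qed.

(** The arc multiplicities are symmetric in the two endpoints. *)
Lemma balanced_weight : balanced (hyperflow weight_deg weight_in).
Proof.
apply/forallP => u; apply/eqP; apply: eq_bigr => v _.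
by rewrite !hyperflow_weight eq_sym; under eq_bigl => q do rewrite andbC.
Qed.

Lemma sum_weight_deg : (\sum_v weight_deg v = k * \sum_q w q)%N.
Proof.
under eq_bigr => v _ do rewrite -vdeg_weight /vdeg big_mkcond.
rewrite exchange_big big_distrr /=; apply: eq_bigr => q _.
rewrite -big_mkcond sum_nat_const.
by rewrite card_hypercycle_edge.
Qed.

End Flow.

Lemma sum_own (F : V -> nat) q : (\sum_v (own v == q) * F v = \sum_r F (vtx q r))%N.
Proof.
rewrite big_vtx /= (bigD1 q) //= [X in (_ + X)%N]big1 ?addn0.
  by apply: eq_bigr => r _; rewrite own_vtx eqxx mul1n.
move=> s /negbTE sq; apply: big1 => r _; by rewrite own_vtx sq.
Qed.

Variables a j : V -> nat.
Hypothesis adm : admissible a j.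
Hypothesis bal : balanced (hyperflow a j).

(* The number of hyperarcs following the edge [q]. *)
Let load (q : 'I_m) : nat :=
  (\sum_r (a (vtx q r) - j (vtx q r)) + \sum_r j (vtx (ordS q) r))%N.

Let w (q : 'I_m) : nat := a (core_vtx q).

(** By balance, [a v * k.-1] hyperarcs with another tail reach [v]. Together with the [a v]
    hyperarcs with tail [v], these are all those following an edge through [v]. *)
Let a_load v :
  (a v * k = load (own v) + joint v * load (ord_pred (own v)))%N.
Proof.
have [jv jj] := andP (forallP adm v).
have loadE q : load q = (\sum_u ((own u == q) * (a u - j u) +
                                 (ord_pred (own u) == q) * j u))%N.
  rewrite big_split /= sum_own; congr (_ + _)%N; rewrite -sum_own.
  by apply: eq_bigr => u _; rewrite -(can_eq (@ord_predK _)) ordSK.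
have inE : (\sum_q (v \in E q) * load q =
    \sum_u ((a u - j u) * (v \in E (own u)) +
            j u * (v \in E (ord_pred (own u)))))%N.
  under eq_bigr => q _ do rewrite loadE big_distrr /=.
  rewrite exchange_big; apply: eq_bigr => u _ /=.
  under eq_bigr => q _ do rewrite mulnDr.
  rewrite big_split /=; congr (_ + _)%N.
    rewrite (bigD1 (own u)) //= eqxx mul1n big1 ?addn0 1?mulnC // => q.
    by rewrite eq_sym => /negbTE->; rewrite mul0n muln0.
  rewrite (bigD1 (ord_pred (own u))) //= eqxx mul1n big1 ?addn0 1?mulnC // => q.
  by rewrite eq_sym => /negbTE->; rewrite mul0n muln0.
have -> : (load (own v) + joint v * load (ord_pred (own v)) =
           \sum_q (v \in E q) * load q)%N.
  transitivity (\sum_(q | v \in E q) load q)%N.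
    rewrite (big_mem_edge load); congr addn.
    by case: (joint v); rewrite ?mul1n ?mul0n.
  rewrite big_mkcond; apply: eq_bigr => q _.
  by case: (v \in E q); rewrite ?mul1n ?mul0n.
have out : (\sum_u hyperflow a j (xvar u v) = a v * k.-1)%N.
  by rewrite -(outdeg_hyperflow v adm); apply/esym/eqP/(forallP bal).
have kE : k = k.-1.+1 by lia.
rewrite inE [in LHS]kE mulnS -out (bigD1 v) //=.
rewrite [in RHS](bigD1 v) //= hyperflowE eqxx mul0n add0n; congr addn.
  have ov : v \in E (own v) by rewrite mem_hypercycle_edge eqxx.
  rewrite ov muln1; case/orP: jj => [jtv|/eqP->]; last by rewrite mul0n addn0 subn0.
  have -> : v \in E (ord_pred (own v)).
    by rewrite mem_hypercycle_edge jtv ord_predK eqxx orbT.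
  by rewrite muln1 subnK.
by apply: eq_bigr => u uv; rewrite hyperflowE uv mul1n.
Qed.

Let k_gt0 : (0 < k)%N. Proof. by lia. Qed.

Let loadE q : load q = (k * w q)%N.
Proof.
have := a_load (core_vtx q); rewrite own_vtx joint_vtx /= mul0n addn0 => <-.
exact: mulnC.
Qed.

Lemma balanced_weight_deg v : a v = weight_deg w v.
Proof.
apply/eqP; rewrite -(eqn_pmul2r k_gt0) a_load !loadE /weight_deg /weight_in.
by apply/eqP; ring.
Qed.

Lemma admissible_joint v : ~~ joint v -> j v = 0%N.
Proof. by have /andP[_ /orP[->|/eqP]] := forallP adm v. Qed.

(** Compares the load of [q], summed over its tails, with [k * w q]. It says that the excess of
    [j (first_vtx q)] over [w (ord_pred q)] is the same at all joints. *)
Lemma balanced_circulation q :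
  (w q + j (first_vtx q) = w (ord_pred q) + j (first_vtx (ordS q)))%N.
Proof.
have sum_j s : (\sum_r j (vtx s r) = j (first_vtx s))%N.
  rewrite -(sum_joint s j); apply: eq_bigr => r _.
  by case: ifPn => // /admissible_joint.
have sum_a : (\sum_r a (vtx q r) = k.-1 * w q + w (ord_pred q))%N.
  under eq_bigr => r _ do rewrite balanced_weight_deg.
  rewrite big_split /= /weight_in.
  under eq_bigr => r _ do rewrite own_vtx.
  rewrite sum_nat_const card_ord; congr addn.
  pose F (v : V) : nat := w (ord_pred (own v)).
  have := sum_joint q F; rewrite {2}/F own_vtx => <-.
  by apply: eq_bigr => r _; case: (joint _); rewrite ?mul1n ?mul0n.
have sum_aj : (\sum_r (a (vtx q r) - j (vtx q r)) + \sum_r j (vtx q r) =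
               \sum_r a (vtx q r))%N.
  rewrite -big_split; apply: eq_bigr => r _ /=; rewrite subnK //.
  by have /andP[] := forallP adm (vtx q r).
have := loadE q; rewrite /load; move: sum_aj; rewrite sum_a !sum_j.
have -> : (k * w q = k.-1 * w q + w q)%N by rewrite -[in LHS](prednK k_gt0) mulSnr.
lia.
Qed.

Lemma sum_balanced : (\sum_v a v = k * \sum_q w q)%N.
Proof. by rewrite -sum_weight_deg; apply: eq_bigr => v _; rewrite balanced_weight_deg. Qed.

End Hypercycle.

(** * The hypercycle of length four *)

Lemma det_mx33 (R : comNzRingType) (f : nat -> nat -> R) :
  \det (\matrix_(i < 3, j < 3) f i j) =
  f 0%N 0%N * (f 1%N 1%N * f 2%N 2%N - f 1%N 2%N * f 2%N 1%N) -
  f 0%N 1%N * (f 1%N 0%N * f 2%N 2%N - f 1%N 2%N * f 2%N 0%N) +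
  f 0%N 2%N * (f 1%N 0%N * f 2%N 1%N - f 1%N 1%N * f 2%N 0%N).
Proof.
rewrite (expand_det_row _ ord0) !big_ord_recl big_ord0 /cofactor.
rewrite !(expand_det_row _ ord0) !big_ord_recl !big_ord0 /cofactor !det_mx11 !mxE.
rewrite /= /bump /= ?addn0 ?add0n ?[(1 + 1)%N]/2%N.
by ring.
Qed.

(* Each term deletes one index of the 4-cycle, which leaves a path. *)
Lemma tr_adj_cycle4 (R : comNzRingType) (f : nat -> nat -> R) :
  f 0%N 2%N = 0 -> f 2%N 0%N = 0 -> f 1%N 3%N = 0 -> f 3%N 1%N = 0 ->
  let d i := f i i in let c i j := f i j * f j i in
  let path3 i j l := d i * d j * d l - d i * c j l - d l * c i j in
  \tr (\adj (\matrix_(i < 4, j < 4) f i j)) =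
  path3 1%N 2%N 3%N + path3 2%N 3%N 0%N + path3 3%N 0%N 1%N + path3 0%N 1%N 2%N.
Proof.
move=> f02 f20 f13 f31 d c path3.
pose g l (i j : nat) := f (bump l i) (bump l j).
have minor (l : 'I_4) : cofactor (\matrix_(i < 4, j < 4) f i j) l l =
    \det (\matrix_(i < 3, j < 3) g l i j).
  rewrite /cofactor -signr_odd oddD addbb mul1r; congr (\det _).
  by apply/matrixP=> i j; rewrite !mxE.
rewrite /mxtrace !big_ord_recl big_ord0.
rewrite ![(\adj _) _ _]mxE !minor !det_mx33 /g /bump /= ?addn0 ?add0n.
rewrite -?[(1 + 1)%N]/2%N -?[(1 + 2)%N]/3%N /= -?[(1 + 1)%N]/2%N -?[(1 + 2)%N]/3%N.
rewrite /path3 /d /c.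
rewrite f02 f20 f13 f31; ring.
Qed.

Lemma sum_ord_eq0 (R : nmodType) n (G : bool -> R) : (0 < n)%N ->
  \sum_(r < n) G (r == 0 :> nat) = G true + G false *+ n.-1.
Proof.
case: n => // n _; rewrite big_ord_recl; congr (_ + _).
by rewrite (eq_bigr (fun=> G false)) // sumr_const card_ord.
Qed.

(** Over an explicit list of natural numbers, the compositions of 3 are found by computation. *)
Lemma sum_compositions (R : nmodType) (f : nat -> nat -> nat -> nat -> R) :
  \sum_(x : 'I_4 * 'I_4 * 'I_4 * 'I_4 |
         (x.1.1.1 + x.1.1.2 + x.1.2 + x.2 == 3)%N)
      f x.1.1.1 x.1.1.2 x.1.2 x.2 =
  \sum_(x <- [seq x <- [seq (y, x3) | y <- [seq (z, x2) |
        z <- [seq (x0, x1) | x0 <- iota 0 4, x1 <- iota 0 4],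
        x2 <- iota 0 4], x3 <- iota 0 4] |
        (x.1.1.1 + x.1.1.2 + x.1.2 + x.2 == 3)%N])
      f x.1.1.1 x.1.1.2 x.1.2 x.2.
Proof.
have ordE (G : nat -> R) : \sum_(i < 4) G i = \sum_(i <- iota 0 4) G i.
  by rewrite -(big_mkord xpredT).
rewrite big_filter big_mkcond [RHS]big_mkcond !big_allpairs.
pose F (x0 x1 x2 x3 : nat) :=
  if (x0 + x1 + x2 + x3 == 3)%N then f x0 x1 x2 x3 else 0.
rewrite -(pair_bigA _ (fun (y : 'I_4 * 'I_4 * 'I_4) (x3 : 'I_4) =>
  F y.1.1 y.1.2 y.2 x3)) /=.
rewrite -(pair_bigA _ (fun (y : 'I_4 * 'I_4) (x2 : 'I_4) =>
  \sum_(x3 < 4) F y.1 y.2 x2 x3)) /=.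
rewrite -(pair_bigA _ (fun x0 x1 : 'I_4 =>
  \sum_(x2 < 4) \sum_(x3 < 4) F x0 x1 x2 x3)) /=.
rewrite -ordE; apply: eq_bigr => x0 _; rewrite -ordE; apply: eq_bigr => x1 _.
rewrite -ordE; apply: eq_bigr => x2 _; rewrite -ordE; exact: eq_bigr.
Qed.

Definition weights4 (w0 w1 w2 w3 : nat) (q : 'I_4) : nat :=
  nth 0%N [:: w0; w1; w2; w3] q.

Section FourCycle.

Variables (C : numFieldType) (k : nat).
Hypothesis k_gt2 : (2 < k)%N.

Let m_gt1 : (1 < 4)%N := isT.

Local Notation V := 'I_(4 * k.-1).
Local Notation E := (@hypercycle_edge 4 k).
Local Notation own4 := (@own 4 k m_gt1 k_gt2).
Local Notation vtx4 := (@vtx 4 k m_gt1 k_gt2).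
Local Notation first_vtx4 := (@first_vtx 4 k m_gt1 k_gt2).
Local Notation core_vtx4 := (@core_vtx 4 k m_gt1 k_gt2).
Local Notation hyperflow4 := (@hyperflow 4 k m_gt1 k_gt2).
Local Notation deg4 := (@weight_deg 4 k m_gt1 k_gt2).
Local Notation in4 := (@weight_in 4 k m_gt1 k_gt2).

Let q0 : 'I_4 := Ordinal (isT : 0 < 4)%N.
Let q1 : 'I_4 := Ordinal (isT : 1 < 4)%N.
Let q2 : 'I_4 := Ordinal (isT : 2 < 4)%N.
Let q3 : 'I_4 := Ordinal (isT : 3 < 4)%N.

Lemma big_ord4 (R : Type) (idx : R) (op : Monoid.law idx) (F : 'I_4 -> R) :
  \big[op/idx]_q F q = op (F q0) (op (F q1) (op (F q2) (F q3))).
Proof.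
rewrite !big_ord_recl big_ord0 Monoid.mulm1.
by do !congr (op _ _); congr F; apply: val_inj.
Qed.

Lemma ord4_ind (P : 'I_4 -> Prop) : P q0 -> P q1 -> P q2 -> P q3 -> forall q, P q.
Proof.
move=> P0 P1 P2 P3 [[|[|[|[|q]]]] lt_q] //.
- by rewrite (_ : Ordinal _ = q0) //; apply: val_inj.
- by rewrite (_ : Ordinal _ = q1) //; apply: val_inj.
- by rewrite (_ : Ordinal _ = q2) //; apply: val_inj.
- by rewrite (_ : Ordinal _ = q3) //; apply: val_inj.
Qed.

Lemma ordS4 : (ordS q0 = q1) * (ordS q1 = q2) * (ordS q2 = q3) * (ordS q3 = q0).
Proof. by do !split; apply: val_inj. Qed.

Lemma ord_pred4 : (ord_pred q0 = q3) * (ord_pred q1 = q0) *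
  (ord_pred q2 = q1) * (ord_pred q3 = q2).
Proof. by do !split; apply: val_inj. Qed.

(* Since the weights add up to 3, one of the four edges is unused, so that no
   flow can circulate around the hypercycle. *)
Lemma hyperflow4_class (a j : V -> nat) :
  admissible a j -> balanced (hyperflow4 a j) -> (\sum_v a v = 3 * k)%N ->
  let w q := a (core_vtx4 q) in
  [/\ (\sum_q w q = 3)%N, a =1 deg4 w & j =1 in4 w].
Proof.
move=> adm bal suma w.
have aE : a =1 deg4 w by move=> v; apply: (balanced_weight_deg adm bal).
have sumw : (\sum_q w q = 3)%N.
  apply/eqP; rewrite -(@eqn_pmul2l k); last by lia.
  by rewrite -(sum_balanced adm bal) suma mulnC.
split=> //.
have step := balanced_circulation adm bal.
have jb q : (j (first_vtx4 q) <= w q + w (ord_pred q))%N.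
  have /andP[] := forallP adm (first_vtx4 q).
  by rewrite aE /weight_deg /weight_in own_vtx joint_vtx mul1n.
have jE : forall q, j (first_vtx4 q) = w (ord_pred q).
  move: sumw (step q0) (step q1) (step q2) (step q3) (jb q0) (jb q1) (jb q2) (jb q3).
  rewrite big_ord4 /= !ordS4 !ord_pred4 -/(w _) => s e0 e1 e2 e3 b0 b1 b2 b3.
  rewrite -/(w q1) -/(w q2) -/(w q3) in e0 e1 e2 e3.
  by apply: ord4_ind; rewrite !ord_pred4; lia.
move=> v; rewrite /weight_in; have [jv|jv] := boolP (joint v); last first.
  by rewrite (admissible_joint adm jv) mul0n.
have vE : v = first_vtx4 (own4 v).
  apply: val_inj => /=; rewrite addn0 [LHS](divn_eq v k.-1).
  by move: jv; rewrite /joint => /eqP->; rewrite addn0.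
by rewrite mul1n {1}vE jE.
Qed.

Lemma weight_le3 (w : 'I_4 -> nat) q : (\sum_q w q = 3)%N -> (w q <= 3)%N.
Proof. by move=> <-; rewrite (bigD1 q) //= leq_addr. Qed.

Definition flow_term (w : 'I_4 -> nat) : C :=
  (\prod_v 'C(deg4 w v, in4 w v))%:R *
  \tr (\adj (walk_laplacian C (hyperflow4 (deg4 w) (in4 w)))).

(** The bound [3 + 3 <= 3 * k] makes the counts fit the ordinals that index the trace. *)
Lemma weight_deg_le (w : 'I_4 -> nat) v : (\sum_q w q = 3)%N ->
  (deg4 w v <= 3 * k)%N.
Proof.
move=> sumw; have lew q := weight_le3 q sumw.
rewrite /weight_deg /weight_in.
have := lew (own4 v); have := lew (ord_pred (own4 v)).
by case: (joint v); lia.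
Qed.

Lemma hypercycle4_trace :
  tensor_trace (3 * k) (adjacency_tensor C k (hypercycle 4 k)) =
  (k.-1%:R ^+ (4 * k.-1).-1 *
    \sum_(x : 'I_4 * 'I_4 * 'I_4 * 'I_4 |
          (x.1.1.1 + x.1.1.2 + x.1.2 + x.2 == 3)%N)
      flow_term (weights4 x.1.1.1 x.1.1.2 x.1.2 x.2))%:MP.
Proof.
rewrite (hypercycle_trace m_gt1 k_gt2 C); congr (_ * _)%:MP.
rewrite pair_big_dep /=.
pose W (x : 'I_4 * 'I_4 * 'I_4 * 'I_4) := weights4 x.1.1.1 x.1.1.2 x.1.2 x.2.
have WE x : (\sum_q W x q = x.1.1.1 + x.1.1.2 + x.1.2 + x.2)%N.
  by rewrite big_ord4 /= !addnA.
pose to_flow x : {ffun V -> 'I_(3 * k).+1} * {ffun V -> 'I_(3 * k).+1} :=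
  ([ffun v => inord (deg4 (W x) v)], [ffun v => inord (in4 (W x) v)]).
pose of_flow (f : {ffun V -> 'I_(3 * k).+1} * {ffun V -> 'I_(3 * k).+1})
   : 'I_4 * 'I_4 * 'I_4 * 'I_4 :=
  (inord (f.1 (core_vtx4 q0)), inord (f.1 (core_vtx4 q1)),
   inord (f.1 (core_vtx4 q2)), inord (f.1 (core_vtx4 q3))).
have of_flowE (f : {ffun V -> 'I_(3 * k).+1} * {ffun V -> 'I_(3 * k).+1}) q :
    (\sum_s (f.1 (core_vtx4 s) : nat) = 3)%N ->
    W (of_flow f) q = f.1 (core_vtx4 q).
  move=> sumf; have lef s : (f.1 (core_vtx4 s) < 4)%N :=
    weight_le3 (w := fun s => f.1 (core_vtx4 s)) s sumf.
  by move: q; apply: ord4_ind; rewrite /W /weights4 /= inordK.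
rewrite (reindex_onto to_flow of_flow) /=; last first.
  case=> a j /= /andP[/eqP suma /andP[adm bal]].
  pose w (q : 'I_4) : nat := a (core_vtx4 q).
  have [sumw aE jE] : [/\ (\sum_q w q = 3)%N, forall v, a v = deg4 w v :> nat
      & forall v, j v = in4 w v :> nat] := hyperflow4_class adm bal suma.
  have wE q : W (of_flow (a, j)) q = w q := of_flowE (a, j) q sumw.
  have aE' v : deg4 (W (of_flow (a, j))) v = a v.
    by rewrite [RHS]aE /weight_deg /weight_in !wE.
  have jE' v : in4 (W (of_flow (a, j))) v = j v.
    by rewrite [RHS]jE /weight_in !wE.
  by congr (_, _); apply/ffunP => v; rewrite ffunE ?aE' ?jE' inord_val.
have to_flowE x : (\sum_q W x q = 3)%N ->
    ((fun v => (to_flow x).1 v : nat) =1 deg4 (W x)) *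
    ((fun v => (to_flow x).2 v : nat) =1 in4 (W x)).
  move=> sumx; have le3k v := weight_deg_le v sumx.
  split=> v; rewrite ffunE inordK // ltnS //.
  by apply: leq_trans (le3k v); apply: leq_addl.
have hyperflow_ext a a' j j' : a =1 a' -> j =1 j' ->
    hyperflow4 a j = hyperflow4 a' j'.
  by move=> ea ej; apply: eq_bigr => u _; rewrite ea ej.
have ofK x : (\sum_q W x q = 3)%N -> of_flow (to_flow x) = x.
  move=> sumx; have core q : deg4 (W x) (core_vtx4 q) = W x q.
    by rewrite /weight_deg /weight_in own_vtx joint_vtx mul0n addn0.
  rewrite /of_flow !(to_flowE x sumx).1 !core.
  by case: x {sumx core} => [[[x0 x1] x2] x3]; rewrite /W /weights4 /= !inord_val.
(* Here [inord] might have altered the counts, as the weights of [x] are not yet known to add up to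
   3. The sum is read off the flow and carried back by the round trip. *)
have fwd x : (\sum_v (to_flow x).1 v = 3 * k)%N ->
    admissible (fun u => (to_flow x).1 u) (fun u => (to_flow x).2 u) ->
    balanced (hyperflow4 (fun u => (to_flow x).1 u) (fun u => (to_flow x).2 u)) ->
    of_flow (to_flow x) = x -> (\sum_q W x q = 3)%N.
  move=> suma adm bal ofx; have [sumw _ _] := hyperflow4_class adm bal suma.
  rewrite -[RHS]sumw; apply: eq_bigr => q _.
  by rewrite -[RHS](of_flowE (to_flow x) q sumw) ofx.
apply: eq_big => [x|x /andP[/andP[/eqP suma /andP[adm bal]] /eqP ofx]].
  rewrite -WE; apply/idP/eqP => [/andP[/andP[/eqP suma /andP[adm bal]] /eqP ofx]|sumx].
    exact: (fwd x).
  rewrite (introT eqP (ofK x sumx)) andbT.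
  have [aE jE] := to_flowE x sumx.
  apply/and3P; split.
  - by rewrite (eq_bigr _ (fun v _ => aE v)) sum_weight_deg sumx mulnC.
  - rewrite /admissible; under eq_forallb => v do rewrite aE jE.
    exact: admissible_weight.
  - by rewrite (hyperflow_ext _ _ _ _ aE jE); apply: balanced_weight.
have [aE jE] := to_flowE x (fwd x suma adm bal ofx).
rewrite (hyperflow_ext _ _ _ _ aE jE); congr (_%:R * _).
by apply: eq_bigr => v _; congr 'C(_, _); [exact: aE | exact: jE].
Qed.

(** * The matrix indexed by the edges *)

Section Evaluation.

Variable w : 'I_4 -> nat.

Definition joint_weight (q : 'I_4) : nat := (w q + w (ord_pred q))%N.

Lemma weight_deg_vtx q r :
  deg4 w (vtx4 q r) = if r == 0 :> nat then joint_weight q else w q.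
Proof.
rewrite /weight_deg /weight_in own_vtx joint_vtx.
by case: (_ == _); rewrite ?mul1n ?mul0n ?addn0.
Qed.

Lemma prod_binomial_weight :
  (\prod_v 'C(deg4 w v, in4 w v) =
   \prod_q 'C(joint_weight q, w (ord_pred q)))%N.
Proof.
rewrite (big_vtx m_gt1 k_gt2) /=; apply: eq_bigr => q _.
have p_gt0 : (0 < k.-1)%N by lia.
rewrite (bigD1 (Ordinal p_gt0)) //= [X in (_ * X)%N]big1 ?muln1.
  by rewrite weight_deg_vtx /weight_in own_vtx joint_vtx mul1n.
move=> r r0; rewrite /weight_in joint_vtx.
have -> : (r == 0 :> nat) = false by apply/negbTE.
by rewrite mul0n bin0.
Qed.

Lemma card_weight_support :
  (#|[set v | vdeg E w v != 0]| =
   \sum_q ((joint_weight q != 0) + k.-2 * (w q != 0)))%N.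
Proof.
rewrite -sum1_card big_mkcond /= (big_vtx m_gt1 k_gt2) /=; apply: eq_bigr => q _.
pose G b : nat := (if b then joint_weight q else w q) != 0%N.
transitivity (\sum_(r < k.-1) G (r == 0 :> nat)).
  apply: eq_bigr => r _; rewrite inE (vdeg_weight m_gt1 k_gt2) weight_deg_vtx /G.
  by case: ((if _ then _ else _) != _).
rewrite sum_ord_eq0; last by lia.
congr addn; rewrite /G; case: (_ != _); rewrite ?muln1 ?muln0 ?mul0rn //.
by elim: k.-2 => // n IHn; rewrite mulrS IHn.
Qed.

(** The vertices are split into joints and the [k - 2] others of each block, which lie on one edge
    only. For [w q = 0] the diagonal entry is 0, by [0^-1 = 0]. *)
Lemma edge_vertex_edgeE q q' :
  (edge_vertex_mx C k E *m vertex_edge_mx C E w) q q' =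
  (w q')%:R / k%:R *
  (\sum_s ((s == q) || (s == ordS q))%:R * ((s == q') || (s == ordS q'))%:R /
     (joint_weight s)%:R + k.-2%:R * (q == q')%:R / (w q)%:R).
Proof.
rewrite mxE (big_vtx m_gt1 k_gt2) /=.
pose G s b : C := (w q')%:R / k%:R *
  (((s == q) || b && (s == ordS q))%:R * ((s == q') || b && (s == ordS q'))%:R /
   (if b then joint_weight s else w s)%:R).
transitivity (\sum_s \sum_(r < k.-1) G s (r == 0 :> nat)).
  apply: eq_bigr => s _; apply: eq_bigr => r _; rewrite !mxE.
  rewrite (vdeg_weight m_gt1 k_gt2) weight_deg_vtx.
  rewrite !(mem_hypercycle_edge m_gt1 k_gt2) own_vtx joint_vtx /G.
  by rewrite !mulrA; congr (_ / _); ring.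
have p_gt0 : (0 < k.-1)%N by lia.
rewrite (eq_bigr _ (fun s _ => sum_ord_eq0 (G s) p_gt0)) big_split /= mulrDr.
congr (_ + _); first by rewrite mulr_sumr.
rewrite (bigD1 q) //= big1 => [|s /negbTE sq]; rewrite /G /=.
  rewrite addr0 eqxx !orbF mul1r -mulr_natl; ring.
by rewrite sq /= !mul0r mulr0 mul0rn.
Qed.

Definition edge_mx : 'M[C]_4 := 1%:M - edge_vertex_mx C k E *m vertex_edge_mx C E w.

Let jinv q : C := (joint_weight q)%:R^-1.

Lemma edge_mx_diag q : edge_mx q q =
  1 - (w q)%:R / k%:R * (jinv q + jinv (ordS q) + k.-2%:R / (w q)%:R).
Proof.
rewrite one_sub_mxE eqxx edge_vertex_edgeE; congr (_ - _ * (_ + _)).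
  move: q; apply: ord4_ind; rewrite (big_ord4 +%R) !ordS4 /= /jinv; ring.
by rewrite eqxx mulr1.
Qed.

Lemma edge_mx_succ q :
  edge_mx q (ordS q) = - ((w (ordS q))%:R / k%:R * jinv (ordS q)).
Proof.
rewrite one_sub_mxE edge_vertex_edgeE.
move: q; apply: ord4_ind; rewrite (big_ord4 +%R) !ordS4 /= /jinv; ring.
Qed.

Lemma edge_mx_pred q :
  edge_mx (ordS q) q = - ((w q)%:R / k%:R * jinv (ordS q)).
Proof.
rewrite one_sub_mxE edge_vertex_edgeE.
move: q; apply: ord4_ind; rewrite (big_ord4 +%R) !ordS4 /= /jinv; ring.
Qed.

Lemma edge_mx_opp q : edge_mx q (ordS (ordS q)) = 0.
Proof.
rewrite one_sub_mxE edge_vertex_edgeE.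
move: q; apply: ord4_ind; rewrite (big_ord4 +%R) !ordS4 /= /jinv; ring.
Qed.

Let diag q : C :=
  1 - (w q)%:R / k%:R * (jinv q + jinv (ordS q) + k.-2%:R / (w q)%:R).
Let link q : C :=
  (w q)%:R * (w (ordS q))%:R * jinv (ordS q) ^+ 2 * k%:R^-1 ^+ 2.
(** The principal minor on three consecutive edges: it is tridiagonal, and [link q] is the product
    of the two entries joining [q] and [ordS q]. *)
Let path3 q : C :=
  diag q * diag (ordS q) * diag (ordS (ordS q))
  - diag q * link (ordS q) - diag (ordS (ordS q)) * link q.

Lemma tr_adj_edge_mx :
  \tr (\adj edge_mx) = path3 q0 + path3 q1 + path3 q2 + path3 q3.
Proof.
pose f i j := edge_mx (inord i) (inord j).
have fE (q q' : 'I_4) : f q q' = edge_mx q q' by rewrite /f !inord_val.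
have -> : edge_mx = \matrix_(i, j) f i j.
  by apply/matrixP => q q'; rewrite mxE fE.
have opp := edge_mx_opp.
rewrite tr_adj_cycle4; first last.
- by rewrite (fE q3 q1) -(opp q3) !ordS4.
- by rewrite (fE q1 q3) -(opp q1) !ordS4.
- by rewrite (fE q2 q0) -(opp q2) !ordS4.
- by rewrite (fE q0 q2) -(opp q0) !ordS4.
have linkE (q : 'I_4) : f q (ordS q) * f (ordS q) q = link q.
  by rewrite !fE edge_mx_succ edge_mx_pred /link; ring.
have diagE (q : 'I_4) : f q q = diag q by rewrite fE edge_mx_diag.
have e0 := linkE q0; have e1 := linkE q1; have e2 := linkE q2; have e3 := linkE q3.
rewrite !ordS4 /= in e0 e1 e2 e3.
have d0 := diagE q0; have d1 := diagE q1; have d2 := diagE q2; have d3 := diagE q3.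
rewrite /= in d0 d1 d2 d3; rewrite /path3 !ordS4 e0 e1 e2 e3 d0 d1 d2 d3.
ring.
Qed.

Hypothesis sum_w3 : (\sum_q w q = 3)%N.

Lemma flow_termE :
  flow_term w = (\prod_q 'C(joint_weight q, w (ord_pred q)))%:R *
   (k%:R / k.-1%:R) ^+
      (\sum_q ((joint_weight q != 0) + k.-2 * (w q != 0)))%N.-1 *
   (path3 q0 + path3 q1 + path3 q2 + path3 q3).
Proof.
rewrite /flow_term prod_binomial_weight -mulrA -tr_adj_edge_mx; congr (_ * _).
have w_neq0 : exists q, w q != 0%N.
  have [q wq|w0] := pickP (fun q => w q != 0%N); first by exists q.
  by move: sum_w3; rewrite big1 // => q _; apply/eqP/negbFE/w0.
rewrite (@tr_adj_walk_laplacian C _ _ k E w) ?card_weight_support //.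
- by lia.
- exact: (card_hypercycle_edge m_gt1 k_gt2).
- exact: hyperflow_weight.
Qed.

End Evaluation.

(** * Values for the twenty weights *)

Local Notation rho := (k%:R / k.-1%:R : C).

Let k_neq0 : k%:R != 0 :> C. Proof. by rewrite pnatr_eq0; lia. Qed.

Let k2E : k.-2%:R = k%:R - 2 :> C.
Proof. by rewrite -natrB; [congr _%:R; lia | lia]. Qed.

Lemma flow_term_value (w0 w1 w2 w3 b e : nat) (t : C) :
  let w := weights4 w0 w1 w2 w3 in
  (w0 + w1 + w2 + w3 = 3)%N ->
  (\prod_q 'C(joint_weight w q, w (ord_pred q)) = b)%N ->
  (\sum_q ((joint_weight w q != 0) + k.-2 * (w q != 0)) = e.+1)%N ->
  \tr (\adj (edge_mx w)) = t ->
  flow_term w = b%:R * rho ^+ e * t.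
Proof.
move=> w sumw <- sE <-; rewrite flow_termE; last by rewrite (big_ord4 addn) /= !addnA.
by rewrite sE tr_adj_edge_mx.
Qed.

Ltac eval_flow_term :=
  apply: flow_term_value;
  [by []
  |by rewrite (big_ord4 muln) /joint_weight !ord_pred4 /weights4 /=
  |rewrite (big_ord4 addn) /joint_weight !ord_pred4 /weights4 /=; lia
  |rewrite tr_adj_edge_mx /joint_weight !ordS4 !ord_pred4;
   rewrite /weights4 /= ?(add0n, addn0, mul0r, mulr0, invr0) k2E].

(* The three factors are the number of orders in which the joints use their two
   edges, the power of [k / (k - 1)] given by the number of vertices used, and
   the trace of the adjugate of the matrix of the edges. *)
Definition single_value : C := 1%:R * rho ^+ k.-1 * 1.
Definition adjacent_value : C := 3%:R * rho ^+ (2 * k - 2) * k%:R^-1.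
Definition opposite_value : C := 1%:R * rho ^+ (2 * k - 1) * 0.
Definition path_value : C := 4%:R * rho ^+ (3 * k - 3) * (3 / 4 / k%:R ^+ 2).

Lemma flow_term_single :
  (flow_term (weights4 3 0 0 0) = single_value) *
  (flow_term (weights4 0 3 0 0) = single_value) *
  (flow_term (weights4 0 0 3 0) = single_value) *
  (flow_term (weights4 0 0 0 3) = single_value).
Proof. by do 3?split; eval_flow_term; field. Qed.

Lemma flow_term_adjacent :
  (flow_term (weights4 2 1 0 0) = adjacent_value) *
  (flow_term (weights4 0 2 1 0) = adjacent_value) *
  (flow_term (weights4 0 0 2 1) = adjacent_value) *
  (flow_term (weights4 1 0 0 2) = adjacent_value) *
  (flow_term (weights4 1 2 0 0) = adjacent_value) *
  (flow_term (weights4 0 1 2 0) = adjacent_value) *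
  (flow_term (weights4 0 0 1 2) = adjacent_value) *
  (flow_term (weights4 2 0 0 1) = adjacent_value).
Proof. by do 7?split; eval_flow_term; field. Qed.

(** Opposite edges share no vertex, so the walk splits into two components and the adjugate
    vanishes: two diagonal entries and all links are 0. *)
Lemma flow_term_opposite :
  (flow_term (weights4 2 0 1 0) = opposite_value) *
  (flow_term (weights4 0 2 0 1) = opposite_value) *
  (flow_term (weights4 1 0 2 0) = opposite_value) *
  (flow_term (weights4 0 1 0 2) = opposite_value).
Proof. by do 3?split; eval_flow_term; field. Qed.

(** Two joints are shared by two used edges, and each contributes ['C(2, 1) = 2], whence the factor
    4. *)
Lemma flow_term_path :
  (flow_term (weights4 1 1 1 0) = path_value) *
  (flow_term (weights4 0 1 1 1) = path_value) *
  (flow_term (weights4 1 0 1 1) = path_value) *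
  (flow_term (weights4 1 1 0 1) = path_value).
Proof. by do 3?split; eval_flow_term; field. Qed.

(** The coefficients are 4 single edges times 1, 8 adjacent weights times 3, and 4 paths times
    [4 * (3 / 4)]. *)
Lemma sum_flow_term :
  \sum_(x : 'I_4 * 'I_4 * 'I_4 * 'I_4 |
         (x.1.1.1 + x.1.1.2 + x.1.2 + x.2 == 3)%N)
      flow_term (weights4 x.1.1.1 x.1.1.2 x.1.2 x.2) =
  4 * rho ^+ k.-1 + 24 * rho ^+ (2 * k - 2) / k%:R +
  12 * rho ^+ (3 * k - 3) / k%:R ^+ 2.
Proof.
rewrite (sum_compositions (fun x0 x1 x2 x3 => flow_term (weights4 x0 x1 x2 x3))).
set s := [seq _ <- _ | _].
have -> : s = [:: (0, 0, 0, 3); (0, 0, 1, 2); (0, 0, 2, 1); (0, 0, 3, 0);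
    (0, 1, 0, 2); (0, 1, 1, 1); (0, 1, 2, 0); (0, 2, 0, 1); (0, 2, 1, 0);
    (0, 3, 0, 0); (1, 0, 0, 2); (1, 0, 1, 1); (1, 0, 2, 0); (1, 1, 0, 1);
    (1, 1, 1, 0); (1, 2, 0, 0); (2, 0, 0, 1); (2, 0, 1, 0); (2, 1, 0, 0);
    (3, 0, 0, 0)]%N by [].
rewrite !big_cons big_nil /=.
rewrite !flow_term_single !flow_term_adjacent !flow_term_opposite !flow_term_path.
rewrite /single_value /adjacent_value /opposite_value /path_value.
by field.
Qed.

Lemma scale_rho (N e : nat) : (e <= N)%N ->
  k.-1%:R ^+ N * rho ^+ e = (k ^ e * k.-1 ^ (N - e))%:R.
Proof.
move=> le_eN; have p_neq0 : k.-1%:R != 0 :> C by rewrite pnatr_eq0; lia.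
rewrite natrM !natrX -{1}(subnK le_eN) exprD expr_div_n mulrCA -mulrA.
by rewrite divff ?mulr1 ?expf_neq0 // mulrC.
Qed.

End FourCycle.

Theorem theorem3p3 (R : realType) (k : nat) (hk : (3 <= k)%N) :
  tensor_trace (3 * k) (adjacency_tensor R[i] k (hypercycle 4 k)) =
  ((4 * k ^ (k - 1) * (k - 1) ^ (3 * k - 4)
    + 24 * k ^ (2 * k - 3) * (k - 1) ^ (2 * k - 3)
    + 12 * k ^ (3 * k - 5) * (k - 1) ^ (k - 2))%N)%:R%:MP.
Proof.
rewrite (hypercycle4_trace _ hk) sum_flow_term; congr _%:MP.
have k_neq0 : k%:R != 0 :> R[i] by rewrite pnatr_eq0; lia.
rewrite !mulrDr ![_ ^+ _.-1 * (_ * _ / _)]mulrA ![_ ^+ _.-1 * (_ * _)]mulrCA.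
rewrite !scale_rho; try lia.
rewrite !natrD; congr (_ + _ + _); rewrite -?subn1.
- have -> : (4 * (k - 1) - 1 - (k - 1) = 3 * k - 4)%N by lia.
  by rewrite -natrM mulnA.
(* The exponent is written as a successor to expose the factor [k] that cancels the division; the
   last summand needs two of them. *)
- have -> : (2 * k - 2 = (2 * k - 3).+1)%N by lia.
  have -> : (4 * (k - 1) - 1 - (2 * k - 3).+1 = 2 * k - 3)%N by lia.
  by rewrite expnS !natrM; field.
have -> : (3 * k - 3 = (3 * k - 5).+2)%N by lia.
have -> : (4 * (k - 1) - 1 - (3 * k - 5).+2 = k - 2)%N by lia.
by rewrite !expnS !natrM; field.
Qed.
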